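(* Let $\{Q_\ell\}_{\ell\in\Lambda}$ be a set of key polynomials for $\nu$ and $i\in\Lambda$. Assume that $\mathrm{in}_\nu Q_i$ is transcendental over $G_{\nu_K}[\mathrm{in}_\nu\mathbf Q_i]$, where $\mathbf Q_i=\{Q_q\}_{q<i}$. Then the set $\{Q_\ell\}_{\ell\in\Lambda}=\{Q_\ell\}_{\ell\le i}$ of key polynomials is complete for $\nu$ (in particular $i$ is the maximal element of $\Lambda$).
   Context: Setting. $K\subset K(x)$ is a simple transcendental extension, $\nu$ a valuation of $K(x)$ with value group $\Gamma$, $\nu_K=\nu|_K$ with value group $\Gamma_0$; $\operatorname{rank}\nu_K=1$, $\nu(x)>0$. $\tilde\Gamma_0=\Gamma_0\otimes_{\mathbb Z}\mathbb Q$, with a fixed ordered embedding into $\mathbb R$; values are compared in $\Gamma\otimes\mathbb Q$. $\mathbb N$ = positive integers, $\mathbb N_0=\mathbb N\cup\{0\}$. $G_\nu=\bigoplus_{\beta\in\Gamma}\mathbf P_\beta/\mathbf P_{\beta+}$ with $\mathbf P_\beta=\{y\in K(x):\nu(y)\ge\beta\}$, $\mathbf P_{\beta+}=\{y:\nu(y)>\beta\}$; $\mathrm{in}_\nu y$ is the class of $y$ in degree $\nu(y)$; $G_{\nu_K}$ is the analogous algebra for $(K,\nu_K)$. For a graded domain $G$, $G^*=\{g/h: g,h\in G,\ h\ne0 \text{ homogeneous}\}$. Index sets. $\Lambda$ is a countable well ordered set with least element $0$; $i+1$ is the successor of $i$, etc. $(\alpha_i)_{i\in\Lambda}$ are positive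 integers, $\alpha_0=1$. $i$ is inessential if $i+\omega\in\Lambda$ and $\alpha_{i+t}=1$ for all $t\in\mathbb N_0$. For non-maximal $i$, $i+$ denotes $i+\omega$ if $i$ is inessential, and $i+1$ otherwise. Pre-key polynomials: monic $Q_i\in K[x]$ $(i\in\Lambda)$, $Q_0=x$, with $\deg Q_i=\alpha_i\deg Q_{i_0}$ for all non-maximal $i\ge1$ and $i_0<i$ with $i_0+=i$. Put $\beta_i=\nu(Q_i)$, $\bar\alpha_i=\deg_xQ_i$, $\mathbf Q_i=\{Q_q\}_{q<i}$. Standard expansions. An $\ell$-standard monomial is $c\prod_{i\le\ell}Q_i^{\gamma_i}$, $c\in K$, $\gamma_i\in\mathbb N_0$ almost all $0$, with $\gamma_i<\alpha_{i+}$ for $i<\ell$ and, for each inessential $i$, at most one $j$ with $j+=i+$ and $\gamma_j\neq0$ (here $i+$ is computed in $\{q\in\Lambda:q\le\ell\}$). It is $Q_\ell$-free if $\gamma_\ell=0$. A $Q_\ell$-free $\ell$-standard expansion is a finite sum of $Q_\ell$-free $\ell$-standard monomials whose $\nu$-value is the minimum of the values of the monomials. An $\ell$-standard expansion of $g\in K[x]$ is $g=\sum_jc_jQ_\ell^j$ with each $c_j$ a $Q_\ell$-free $\ell$-standard expansion. Set of key polynomials for $\nu$: a set of pre-key polynomials such that (a) $\beta_i\in\tilde\Gamma_0$ for $i\ne\max\Lambda$; (b) if $i\ge1$ has an immediate predecessor, $Q_i$ has an $(i-1)$-standard expansion $Q_i=Q_{i-1}^{\alpha_i}+\sum_{j<\alpha_i}\big(\sum_\gamma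 c_{j,\gamma}M_\gamma\big)Q_{i-1}^j$ where the $c_{j,\gamma}M_\gamma$ are $Q_{i-1}$-free $(i-1)$-standard monomials ($c_{j,\gamma}\in K$, $M_\gamma$ a product of powers of elements of $\mathbf Q_{i-1}$; elements of $K$ if $i=1$), all the monomials appearing have the same $\nu$-value, and $(\mathrm{in}_\nu Q_{i-1})^{\alpha_i}+\sum_{j}\big(\sum_\gamma \mathrm{in}_{\nu_K}c_{j,\gamma}\,\mathrm{in}_\nu M_\gamma\big)(\mathrm{in}_\nu Q_{i-1})^j=0$ is the minimal algebraic relation of $\mathrm{in}_\nu Q_{i-1}$ over $G_{\nu_K}[\mathrm{in}_\nu\mathbf Q_{i-1}]^*$; (c) if $i\geq 1$ has no immediate predecessor, there is $i_0$ with $i_0+=i$, and for every such $i_0$ there is an $i_0$-standard expansion $Q_i=\sum_{j=0}^{\alpha_i}c_{j,i_0}Q_{i_0}^j$; every such expansion satisfies $\nu(Q_i)>\min_j\nu(c_{j,i_0}Q_{i_0}^j)$, and $Q_i$ has the smallest degree among polynomials with this property for all $i_0$ with $i_0+=i$; if $\{\beta_{i'}:i'<i\}$ is bounded in $\tilde\Gamma_0$ (in particular if $i\ne\max\Lambda$) then $c_{\alpha_i,i_0}=1$ and $\min_j\nu(c_{j,i_0}Q_{i_0}^j)=\alpha_i\beta_{i_0}=\nu(c_{0,i_0})$; (d) if for some $n$ the set $\{i:\deg Q_i=n\}$ is infinite, then $\{\nu(Q_i):\deg Q_i=n\}$ is cofinal in $\{\nu(f): f\in K[x]\text{ monic},\deg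 f=n\}$. Truncations. Each $f\in K[x]$ has a unique $Q_i$-expansion $f=\sum_jd_{j,i}Q_i^j$ with $\deg d_{j,i}<\deg Q_i$; put $\nu_i(f)=\min_j\{\nu(d_{j,i})+j\beta_i\}$. A set of key polynomials is complete if for every nonzero $f\in K[x]$ there is $i\in\Lambda$ with $\nu_i(f)=\nu(f)$. *)

(* Defs.v *)
From HB Require Import structures.
From mathcomp Require Import all_boot all_order all_algebra.
From mathcomp Require Import generic_quotient ring_quotient fraction finmap.
From mathcomp.multinomials Require Import monalg.

Set Implicit Arguments.
Unset Strict Implicit.
Unset Printing Implicit Defensive.

Import Order.TTheory GRing.Theory Num.Theory.
Local Open Scope ring_scope.
Local Open Scope quotient_scope.

HB.mixin Record isOrderedGroup G of Num.POrderedZmodule G := {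
  ord_total_subproof : forall x y : G, (x <= y) || (y <= x);
  leD2l_subproof : forall z x y : G, x <= y -> z + x <= z + y
}.

#[short(type="ordGroupType")]
HB.structure Definition OrdGroup :=
  { G of isOrderedGroup G & Num.POrderedZmodule G }.

Section OrdGroupTheory.
Variable G : ordGroupType.
Implicit Types x y z : G.

Lemma ord_total x y : (x <= y) || (y <= x).
Proof. exact: ord_total_subproof. Qed.

Lemma ord_ltNge x y : (x < y) = ~~ (y <= x).
Proof. by rewrite comparable_ltNge // /Order.comparable ord_total. Qed.

Lemma leD2lW z x y : x <= y -> z + x <= z + y.
Proof. exact: leD2l_subproof. Qed.

Lemma leD2lE z x y : (z + x <= z + y) = (x <= y).
Proof.
apply/idP/idP; last exact: leD2lW.
by move/(@leD2lW (- z)); rewrite !addKr.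
Qed.

Lemma leDD x y x' y' : x <= x' -> y <= y' -> x + y <= x' + y'.
Proof.
move=> hx hy; apply: (@le_trans _ _ (x + y')); first exact: leD2lW.
by rewrite ![_ + y']addrC; exact: leD2lW.
Qed.

Lemma ltleDD x y x' y' : x < x' -> y <= y' -> x + y < x' + y'.
Proof.
move=> hx hy; rewrite lt_neqAle leDD ?(ltW hx) // andbT.
apply/eqP=> e; move: hx; rewrite lt_leAnge => /andP[_ /negP]; apply.
by rewrite -(leD2lE y) addrC [y + x]addrC e leD2lW.
Qed.
End OrdGroupTheory.

(* Values: [option G] stands for the group G with a largest element [None],   *)
(* the value of 0.                                                            *)

Section ExtendedValues.
Variable G : ordGroupType.
Implicit Types a b c : option G.

Definition ele a b : bool :=
  match a, b with
  | _, None => true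
  | None, Some _ => false
  | Some x, Some y => x <= y
  end.

Definition elt a b : bool := ~~ ele b a.

Definition emin a b : option G := if ele a b then a else b.

Definition eadd a b : option G :=
  match a, b with
  | Some x, Some y => Some (x + y)
  | _, _ => None
  end.

(* [emuln a n] is n times the value a; it is only meant for finite a or n > 0 *)
Definition emuln a n : option G := omap (fun x => x *+ n) a.

Lemma ele_refl a : ele a a.
Proof. by case: a => //= x. Qed.

Lemma ele_trans b a c : ele a b -> ele b c -> ele a c.
Proof. by case: a b c => [x|] [y|] [z|] //=; exact: le_trans. Qed.

Lemma ele_emin c a b : ele c (emin a b) = ele c a && ele c b.
Proof.
rewrite /emin; case: ifPn => h.
  by apply/idP/andP => [ca|[]//]; split=> //; apply: ele_trans h.
have {}h : ele b a by case: a b h => [x|] [y|] //=; rewrite -ord_ltNge => /ltW.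
by apply/idP/andP => [cb|[]//]; split=> //; apply: ele_trans h.
Qed.

Lemma elt_emin c a b : elt c (emin a b) = elt c a && elt c b.
Proof.
rewrite /elt -negb_or /emin; congr (~~ _); case: ifPn => h.
  by apply/idP/orP => [ac|[//|]]; [left | apply: ele_trans].
have {}h : ele b a by case: a b h => [x|] [y|] //=; rewrite -ord_ltNge => /ltW.
by apply/idP/orP => [bc|[|//]]; [right | apply: ele_trans].
Qed.

Lemma elt_ele_trans b a c : elt a b -> ele b c -> elt a c.
Proof. by move=> ab bc; apply: contraNN ab; apply: ele_trans. Qed.

End ExtendedValues.

Record valuation (L : fieldType) (G : ordGroupType) := Valuation {
  valuation_fun :> L -> option G;
  valuation_None : forall y, valuation_fun y = None <-> y = 0;
  valuationM : forall y z,
    valuation_fun (y * z) = eadd (valuation_fun y) (valuation_fun z);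
  valuationD : forall y z,
    ele (emin (valuation_fun y) (valuation_fun z)) (valuation_fun (y + z))
}.

Definition value_group (L : fieldType) (G : ordGroupType)
  (nu : valuation L G) (g : G) : Prop := exists y, nu y = Some g.

Section ValuationTheory.
Variables (L : fieldType) (G : ordGroupType) (nu : valuation L G).

Lemma valuation0 : nu 0 = None.
Proof. by apply/valuation_None. Qed.

Lemma valuation1 : nu 1 = Some 0.
Proof.
case e: (nu 1) => [b|]; last first.
  by move/valuation_None/eqP: e; rewrite oner_eq0.
have := valuationM nu 1 1; rewrite mulr1 e /= => -[] /eqP.
by rewrite -subr_eq0 opprD addNKr oppr_eq0 => /eqP ->.
Qed.

Lemma valuationN1 : nu (-1) = Some 0.
Proof.
case e: (nu (-1)) => [b|]; last first.
  by move/valuation_None/eqP: e; rewrite oppr_eq0 oner_eq0.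
have := valuationM nu (-1) (-1); rewrite mulrNN mulr1 valuation1 e /= => -[] b2.
congr Some; apply: le_anti.
have [h|h] := orP (ord_total 0 b); rewrite h ?andbT /=.
  by have := leD2lW b h; rewrite addr0 -b2 => ->.
by have := leD2lW b h; rewrite addr0 -b2 => ->.
Qed.

Lemma valuationN y : nu (- y) = nu y.
Proof.
by rewrite -mulN1r valuationM valuationN1; case: (nu y) => //= b; rewrite add0r.
Qed.

End ValuationTheory.

Section Restriction.
Variables (K L : fieldType) (f : {rmorphism K -> L}) (G : ordGroupType).
Variable nu : valuation L G.

Lemma vrestr_None c : nu (f c) = None <-> c = 0.
Proof.
split=> [/valuation_None/eqP|->]; last by rewrite rmorph0 valuation0.
by rewrite fmorph_eq0 => /eqP.
Qed.

Lemma vrestrM b c : nu (f (b * c)) = eadd (nu (f b)) (nu (f c)).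
Proof. by rewrite rmorphM valuationM. Qed.

Lemma vrestrD b c : ele (emin (nu (f b)) (nu (f c))) (nu (f (b + c))).
Proof. by rewrite rmorphD valuationD. Qed.

Definition vrestr : valuation K G := Valuation vrestr_None vrestrM vrestrD.

End Restriction.

(* D is nonzero and its only convex subgroups are 0 and D                     *)
Definition rank_one (G : ordGroupType) (D : G -> Prop) : Prop :=
  (exists g, D g /\ g <> 0) /\
  forall H : G -> Prop,
    (forall g, H g -> D g) ->
    H 0 -> (forall g h, H g -> H h -> H (g - h)) ->
    (forall g h, H g -> D h -> 0 <= h <= g -> H h) ->
    (forall g, H g -> g = 0) \/ (forall g, D g -> H g).

(* Membership in D (x) Q for a subgroup D of the torsion free group G, seen   *)
(* inside G (x) Q: g (x) 1 = h (x) 1/n.                                       *)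
Definition in_divisible_hull (G : ordGroupType) (D : G -> Prop) (g : G) : Prop :=
  exists h n, [/\ D h, (0 < n)%N & g *+ n = h].

(* The group algebra L[t^G]; the ring structure of {malg L[_]} in monalg.v    *)
(* excludes exponents with inverses.                                          *)
Definition grpalg (G : zmodType) (L : comNzRingType) : Type := {malg L[G]}.

Section GroupAlgebra.
Variables (G : zmodType) (L : comNzRingType).
Local Open Scope fset_scope.

HB.instance Definition _ := GRing.Zmodule.on (grpalg G L).

Local Notation A := (grpalg G L).
Implicit Types (a b c : A) (k l : G) (x y : L).

Definition gone : A := << 1 *g 0%R >>.

Definition gmul a b : A :=
  \sum_(k <- msupp a) \sum_(l <- msupp b) << a@_k * b@_l *g (k + l)%R >>.

Lemma gmulw (d1 d2 : {fset G}) a b : msupp a `<=` d1 -> msupp b `<=` d2 ->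
  gmul a b = \sum_(k <- d1) \sum_(l <- d2) << a@_k * b@_l *g (k + l)%R >>.
Proof.
move=> le1 le2; rewrite /gmul (big_fset_incl _ le1) /=.
  apply/eq_bigr=> k _; apply/big_fset_incl => // l _ /mcoeff_outdom ->.
  by rewrite mulr0 monalgU0.
move=> k _ /mcoeff_outdom ak.
by rewrite big1 // => l _; rewrite ak mul0r monalgU0.
Qed.

Lemma gmulC : commutative gmul.
Proof.
move=> a b; rewrite /gmul exchange_big; apply: eq_bigr => k _.
by apply: eq_bigr => l _; rewrite mulrC addrC.
Qed.

Lemma gmulDl : left_distributive gmul +%R.
Proof.
move=> a b c.
rewrite [gmul a c](gmulw (fsubsetUl _ (msupp b)) (fsubset_refl _)).
rewrite [gmul b c](gmulw (fsubsetUr (msupp a) _) (fsubset_refl _)).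
rewrite [LHS](gmulw (msuppD_le _ _) (fsubset_refl (msupp c))).
rewrite -big_split /=; apply/eq_bigr=> k _.
rewrite -big_split /=; apply/eq_bigr=> l _.
by rewrite mcoeffD mulrDl monalgUD.
Qed.

Lemma gmul0 : left_zero 0 gmul.
Proof. by move=> a; rewrite /gmul msupp0 big_seq_fset0. Qed.

Lemma gmulDr : right_distributive gmul +%R.
Proof. by move=> a b c; rewrite gmulC gmulDl ![gmul _ a]gmulC. Qed.

Lemma gmul0r : right_zero 0 gmul.
Proof. by move=> a; rewrite gmulC gmul0. Qed.

Lemma gmulUU x y k l :
  gmul << x *g k >> << y *g l >> = << x * y *g (k + l)%R >>.
Proof. by rewrite (gmulw msuppU_le msuppU_le) !big_seq_fset1 !mcoeffUU. Qed.

Lemma gmul_suml I (r : seq I) (F : I -> A) b :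
  gmul (\sum_(i <- r) F i) b = \sum_(i <- r) gmul (F i) b.
Proof. exact: (big_morph (gmul^~ b) (fun _ _ => gmulDl _ _ _) (gmul0 _)). Qed.

Lemma gmul_sumr I (r : seq I) (F : I -> A) b :
  gmul b (\sum_(i <- r) F i) = \sum_(i <- r) gmul b (F i).
Proof. exact: (big_morph (gmul b) (fun _ _ => gmulDr _ _ _) (gmul0r _)). Qed.

Lemma grpalgE a : a = \sum_(k <- msupp a) (<< a@_k *g k >> : A).
Proof. exact: monalgE. Qed.

Lemma gmul1 : left_id gone gmul.
Proof.
move=> a; rewrite [a]grpalgE gmul_sumr; apply: eq_bigr => k _.
by rewrite gmulUU mul1r add0r.
Qed.

Lemma gmulA : associative gmul.
Proof.
have lin a b c : gmul a (gmul b c) =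
    \sum_(k <- msupp a) \sum_(l <- msupp b) \sum_(m <- msupp c)
      gmul << a@_k *g k >> (gmul << b@_l *g l >> << c@_m *g m >>).
  rewrite {1}[a]grpalgE gmul_suml; apply: eq_bigr => k _.
  rewrite {1}[b]grpalgE gmul_suml gmul_sumr; apply: eq_bigr => l _.
  by rewrite [X in gmul _ (gmul _ X) = _]grpalgE gmul_sumr gmul_sumr.
move=> a b c; rewrite lin [RHS]gmulC lin [RHS]exchange_big /=.
under [RHS]eq_bigr => l _ do rewrite exchange_big /=.
apply: eq_bigr => k _; apply: eq_bigr => l _.
apply: eq_bigr => m _.
by rewrite !gmulUU [in RHS]mulrC mulrA [in RHS]addrC addrA.
Qed.

Lemma gone_neq0 : gone != 0.
Proof. by rewrite /gone monalgU_eq0 oner_eq0. Qed.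

HB.instance Definition _ := GRing.Zmodule_isComNzRing.Build (grpalg G L)
  gmulA gmulC gmul1 gmulDl gone_neq0.

Lemma grpalg1E : 1 = << 1 *g 0%R >> :> A.
Proof. by []. Qed.

Lemma grpalgMw (d1 d2 : {fset G}) a b : msupp a `<=` d1 -> msupp b `<=` d2 ->
  a * b = \sum_(k <- d1) \sum_(l <- d2) (<< a@_k * b@_l *g (k + l)%R >> : A).
Proof. exact: gmulw. Qed.

Lemma grpalgMU x y k l :
  (<< x *g k >> : A) * << y *g l >> = << x * y *g (k + l)%R >>.
Proof. exact: gmulUU. Qed.

End GroupAlgebra.

(* The graded algebra of a valuation. With P_b = {y | nu y >= b} and          *)
(* P_b+ = {y | nu y > b}, it is obtained as the quotient of the subring       *)
(* (+)_b P_b t^b of L[t^G] by its ideal (+)_b P_b+ t^b.                       *)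

Section Rees.
Variables (L : fieldType) (G : ordGroupType) (nu : valuation L G).
Implicit Types a b : grpalg G L.

Definition rees_pred : pred (grpalg G L) :=
  fun a => all (fun k => ele (Some k) (nu a@_k)) (msupp a).

Lemma rees_predP a :
  reflect (forall k, ele (Some k) (nu a@_k)) (a \in rees_pred).
Proof.
apply: (iffP allP) => [h k|h k _ //].
by case: (msuppP a k) => [/h //|_]; rewrite valuation0.
Qed.

Lemma ele_sum c I (r : seq I) (P : pred I) (F : I -> L) :
  (forall i, P i -> ele c (nu (F i))) -> ele c (nu (\sum_(i <- r | P i) F i)).
Proof.
move=> h; apply: (big_ind (fun y => ele c (nu y))) => //.
  by rewrite valuation0; case: c {h}.
by move=> y z hy hz; apply: ele_trans (valuationD nu y z); rewrite ele_emin hy.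
Qed.

Lemma elt_sum c I (r : seq I) (P : pred I) (F : I -> L) :
  c <> None ->
  (forall i, P i -> elt c (nu (F i))) -> elt c (nu (\sum_(i <- r | P i) F i)).
Proof.
move=> hc h; apply: (big_ind (fun y => elt c (nu y))) => //.
  by rewrite valuation0; case: c hc {h}.
move=> y z hy hz; apply: elt_ele_trans (valuationD nu y z).
by rewrite elt_emin hy.
Qed.

Lemma gmul_coeff a b k :
  (a * b)@_k = \sum_(l <- msupp a) \sum_(m <- msupp b)
                 (a@_l * b@_m) *+ (l + m == k).
Proof.
rewrite [_ * _]/(gmul a b) /gmul raddf_sum; apply: eq_bigr => l _.
by rewrite raddf_sum; apply: eq_bigr => m _; rewrite /= mcoeffU.
Qed.

Lemma rees_subring : subring_closed rees_pred.
Proof.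
split=> [|a b /rees_predP ha /rees_predP hb|a b /rees_predP ha /rees_predP hb].
- apply/rees_predP => k; rewrite grpalg1E mcoeffU.
  case: eqP => [<-|_]; last by rewrite mulr0n valuation0.
  by rewrite mulr1n valuation1 /=.
- apply/rees_predP => k; rewrite mcoeffB.
  by apply: ele_trans (valuationD _ _ _); rewrite ele_emin valuationN ha hb.
- apply/rees_predP => k; rewrite gmul_coeff.
  apply: ele_sum => l _; apply: ele_sum => m _.
  case: eqP => [<-|_]; last by rewrite mulr0n valuation0.
  rewrite mulr1n valuationM; have := ha l; have := hb m.
  by case: (nu a@_l) (nu b@_m) => [x|] [y|] //= *; apply: leDD.
Qed.

HB.instance Definition _ :=
  GRing.isSubringClosed.Build (grpalg G L) rees_pred rees_subring.

Record rees := Rees { rees_val : grpalg G L; _ : rees_val \in rees_pred }.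
HB.instance Definition _ := [isSub for rees_val].
HB.instance Definition _ := [Choice of rees by <:].
HB.instance Definition _ := [SubChoice_isSubComNzRing of rees by <:].

Definition rees_plus (a : rees) : bool :=
  all (fun k => elt (Some k) (nu (val a)@_k)) (msupp (val a)).

Lemma rees_plusP (a : rees) :
  reflect (forall k, elt (Some k) (nu (val a)@_k)) (a \in rees_plus).
Proof.
apply: (iffP allP) => [h k|h k _ //].
by case: (msuppP (val a) k) => [/h //|_]; rewrite valuation0.
Qed.

Lemma rees_plus_ideal : idealr_closed rees_plus.
Proof.
split=> [||a u v /rees_plusP hu /rees_plusP hv].
- by apply/rees_plusP => k; rewrite mcoeff0 valuation0.
- apply/negP => /rees_plusP /(_ 0).
  by rewrite rmorph1 grpalg1E mcoeffUU valuation1 /elt /= lexx.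
have /rees_predP ha := valP a.
apply/rees_plusP => k; rewrite /= mcoeffD.
apply: elt_ele_trans (valuationD _ _ _); rewrite elt_emin hv andbT.
rewrite gmul_coeff; apply: elt_sum => // l _; apply: elt_sum => // m _.
case: eqP => [<-|_]; last by rewrite mulr0n valuation0.
rewrite mulr1n valuationM; have := ha l; have := hu m.
case: (nu _) (nu _) => [x|] [y|] //=; rewrite /elt /= -!ord_ltNge => h1 h2.
by rewrite [l + m]addrC [x + y]addrC ltleDD.
Qed.

HB.instance Definition _ := isIdealr.Build rees rees_plus rees_plus_ideal.

Definition gr : Type := {ideal_quot (rees_plus : idealr rees)}.
HB.instance Definition _ := GRing.ComNzRing.on gr.

End Rees.

Section GradedAlgebra.
Variables (L : fieldType) (G : ordGroupType) (nu : valuation L G).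
Implicit Types (b c : G) (y z : L).

(* class of y in degree b, for nu y >= b; junk value 0 otherwise *)
Definition grcls b y : gr nu :=
  \pi_(gr nu) (insubd (0 : rees nu) (<< y *g b >> : grpalg G L)).

Definition init y : gr nu := if nu y is Some b then grcls b y else 0.

Definition homogeneous (z : gr nu) : Prop :=
  exists b y, ele (Some b) (nu y) /\ z = grcls b y.

Lemma rees_monom b y : ele (Some b) (nu y) ->
  (<< y *g b >> : grpalg G L) \in rees_pred nu.
Proof.
move=> h; apply/rees_predP => k; rewrite mcoeffU.
by case: eqP => [<-|_]; rewrite ?mulr1n // mulr0n valuation0.
Qed.

Lemma val_rees_monom b y : ele (Some b) (nu y) ->
  val (insubd (0 : rees nu) (<< y *g b >> : grpalg G L)) = << y *g b >>.
Proof. by move=> h; rewrite insubdK // rees_monom. Qed.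

Lemma pi_gr_eq (a a' : rees nu) :
  reflect (\pi_(gr nu) a = \pi_(gr nu) a') (a - a' \in @rees_plus L G nu).
Proof. by rewrite Quotient.idealrBE; apply: eqP. Qed.

Lemma pi_gr_eq0 (a : rees nu) :
  reflect (\pi_(gr nu) a = 0) (a \in @rees_plus L G nu).
Proof.
by rewrite -[a]subr0; apply: (iffP (pi_gr_eq a 0)); rewrite ?subr0 => ->;
  rewrite rmorph0.
Qed.

Lemma grcls_eq0 b y : ele (Some b) (nu y) ->
  grcls b y = 0 <-> elt (Some b) (nu y).
Proof.
move=> h; split=> [/pi_gr_eq0/rees_plusP/(_ b)|lt].
  by rewrite val_rees_monom // mcoeffUU.
apply/pi_gr_eq0/rees_plusP => k; rewrite val_rees_monom // mcoeffU.
by case: eqP => [<-|_]; rewrite ?mulr1n // mulr0n valuation0.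
Qed.

Lemma grclsD b y z : ele (Some b) (nu y) -> ele (Some b) (nu z) ->
  grcls b (y + z) = grcls b y + grcls b z.
Proof.
move=> hy hz; rewrite /grcls -rmorphD; congr (\pi _); apply: val_inj.
have hyz : ele (Some b) (nu (y + z)).
  by apply: ele_trans (valuationD _ _ _); rewrite ele_emin hy.
by rewrite rmorphD /= !val_rees_monom // monalgUD.
Qed.

Lemma grclsM b c y z : ele (Some b) (nu y) -> ele (Some c) (nu z) ->
  grcls (b + c) (y * z) = grcls b y * grcls c z.
Proof.
move=> hy hz; rewrite /grcls -rmorphM; congr (\pi _); apply: val_inj.
have hyz : ele (Some (b + c)) (nu (y * z)).
  rewrite valuationM; move: hy hz.
  by case: (nu y) (nu z) => [u|] [v|] //=; apply: leDD.
by rewrite rmorphM /= !val_rees_monom // grpalgMU.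
Qed.

Lemma init0 : init 0 = 0.
Proof. by rewrite /init valuation0. Qed.

Lemma init_cls b y : nu y = Some b -> init y = grcls b y.
Proof. by rewrite /init => ->. Qed.

Lemma init_eq0 y : init y = 0 <-> y = 0.
Proof.
split=> [|->]; last exact: init0.
case e: (nu y) => [b|]; last by move/valuation_None: e.
have h : ele (Some b) (nu y) by rewrite e /=.
by rewrite (init_cls e) => /(grcls_eq0 h); rewrite e /elt /= lexx.
Qed.

Lemma initM y z : init (y * z) = init y * init z.
Proof.
rewrite /init valuationM.
case ey: (nu y) => [b|]; case ez: (nu z) => [c|] /=; rewrite ?mulr0 ?mul0r //.
by rewrite grclsM ?ey ?ez /=.
Qed.

Lemma init1 : init 1 = 1.
Proof.
rewrite (init_cls (valuation1 nu)) /grcls -(rmorph1 \pi_(gr nu)).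
by congr (\pi _); apply: val_inj; rewrite val_rees_monom ?valuation1 /= ?lexx.
Qed.

(* the nonzero homogeneous elements of gr nu are units, as L is a field *)
Lemma init_unit y : y <> 0 -> init y * init y^-1 = 1.
Proof. by move=> /eqP y0; rewrite -initM divff ?init1. Qed.

Lemma homogeneous_init (z : gr nu) :
  homogeneous z -> z <> 0 -> exists2 y, y <> 0 & z = init y.
Proof.
case=> b [y [h ->]] nz; case e: (nu y) => [c|].
  exists y; first by move/(valuation_None nu); rewrite e.
  have [lt|] := boolP (elt (Some b) (nu y)); first by case: nz; apply/grcls_eq0.
  rewrite /elt negbK e /= => cb; move: h; rewrite e /= => bc.
  by rewrite (init_cls e); congr grcls; apply: le_anti; rewrite bc.
by case: nz; apply/(grcls_eq0 h); rewrite e.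
Qed.

End GradedAlgebra.

(* The inclusion of the graded algebra of the restriction of nu to K into the *)
(* graded algebra of nu. Both are graded by the whole group G; the component  *)
(* of degree b of the former is 0 unless b is in the value group of K.        *)
Section GradedInclusion.
Variables (K L : fieldType) (f : {rmorphism K -> L}) (G : ordGroupType).
Variable nu : valuation L G.

Definition grpalg_map (a : grpalg G K) : grpalg G L :=
  \sum_(b <- msupp a) << f a@_b *g b >>.

Definition rees_map (a : rees (vrestr f nu)) : rees nu :=
  insubd (0 : rees nu) (grpalg_map (val a)).

Definition gr_map (z : gr (vrestr f nu)) : gr nu :=
  \pi_(gr nu) (rees_map (repr z)).

Lemma mcoeff_grpalg_map a k : (grpalg_map a)@_k = f a@_k.
Proof.
rewrite {2}[a]grpalgE !raddf_sum /=; apply: eq_bigr => b _.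
by rewrite !mcoeffU rmorphMn.
Qed.

Lemma val_rees_map a : val (rees_map a) = grpalg_map (val a).
Proof.
rewrite insubdK //; apply/rees_predP => k; rewrite mcoeff_grpalg_map.
by have /rees_predP := valP a; apply.
Qed.

Lemma rees_mapB : {morph rees_map : a b / a - b}.
Proof.
move=> a b; apply: val_inj; rewrite rmorphB /= !val_rees_map.
by apply/malgP => k; rewrite mcoeffB !mcoeff_grpalg_map rmorphB /= mcoeffB rmorphB.
Qed.

Lemma rees_map_monoid : monoid_morphism rees_map.
Proof.
split=> [|a b]; apply: val_inj.
  rewrite !rmorph1 val_rees_map rmorph1; apply/malgP => k.
  by rewrite mcoeff_grpalg_map !grpalg1E !mcoeffU rmorphMn rmorph1.
rewrite rmorphM /= !val_rees_map rmorphM /=; apply/malgP => k.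
have le c : (msupp (grpalg_map c) `<=` msupp c)%fset.
  apply/fsubsetP => l; rewrite -!mcoeff_neq0 mcoeff_grpalg_map.
  by apply: contraNN => /eqP ->; rewrite rmorph0.
rewrite mcoeff_grpalg_map gmul_coeff.
rewrite (grpalgMw (le _) (le _)).
under [in RHS]eq_bigr => l _ do
  under eq_bigr => m _ do rewrite !mcoeff_grpalg_map.
rewrite !raddf_sum /=.
apply: eq_bigr => l _; rewrite !raddf_sum /=; apply: eq_bigr => m _.
by rewrite mcoeffU rmorphMn rmorphM.
Qed.

HB.instance Definition _ :=
  GRing.isZmodMorphism.Build (rees (vrestr f nu)) (rees nu) rees_map rees_mapB.
HB.instance Definition _ :=
  GRing.isMonoidMorphism.Build (rees (vrestr f nu)) (rees nu) rees_map
    rees_map_monoid.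

Lemma gr_map_pi a : gr_map (\pi_(gr (vrestr f nu)) a) = \pi_(gr nu) (rees_map a).
Proof.
apply/pi_gr_eq; rewrite -rmorphB; apply/rees_plusP => k.
rewrite val_rees_map mcoeff_grpalg_map.
have : \pi_(gr (vrestr f nu)) (repr (\pi_(gr (vrestr f nu)) a)) =
       \pi_(gr (vrestr f nu)) a by rewrite reprK.
by move/pi_gr_eq/rees_plusP; apply.
Qed.

Lemma gr_mapB : {morph gr_map : y z / y - z}.
Proof.
move=> y z; rewrite -[y]reprK -[z]reprK -rmorphB !gr_map_pi.
by rewrite rmorphB [LHS]rmorphB.
Qed.

Lemma gr_map_monoid : monoid_morphism gr_map.
Proof.
split=> [|y z]; first by rewrite -(rmorph1 \pi_(gr (vrestr f nu))) gr_map_pi !rmorph1.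
rewrite -[y]reprK -[z]reprK -rmorphM !gr_map_pi.
by rewrite rmorphM [LHS]rmorphM.
Qed.

HB.instance Definition _ :=
  GRing.isZmodMorphism.Build (gr (vrestr f nu)) (gr nu) gr_map gr_mapB.
HB.instance Definition _ :=
  GRing.isMonoidMorphism.Build (gr (vrestr f nu)) (gr nu) gr_map gr_map_monoid.

Lemma gr_map_inj : injective gr_map.
Proof.
move=> y z; rewrite -[y]reprK -[z]reprK !gr_map_pi => /pi_gr_eq/rees_plusP h.
apply/pi_gr_eq/rees_plusP => k.
by have := h k; rewrite -rmorphB val_rees_map mcoeff_grpalg_map.
Qed.

Lemma gr_map_cls b c : ele (Some b) (nu (f c)) ->
  gr_map (grcls (vrestr f nu) b c) = grcls nu b (f c).
Proof.
move=> h; rewrite gr_map_pi; congr (\pi _); apply: val_inj.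
rewrite val_rees_map !val_rees_monom //; apply/malgP => k.
by rewrite mcoeff_grpalg_map !mcoeffU rmorphMn.
Qed.

Lemma gr_map_init c : gr_map (init (vrestr f nu) c) = init nu (f c).
Proof.
rewrite /init /=; case e: (nu (f c)) => [b|]; last exact: rmorph0.
by rewrite gr_map_cls // e /=.
Qed.

End GradedInclusion.

Arguments gr_map {K L} f {G} nu z.

Inductive subring_gen (R : comNzRingType) (S : R -> Prop) : R -> Prop :=
| SubringGen z : S z -> subring_gen S z
| SubringGen1 : subring_gen S 1
| SubringGenB y z :
    subring_gen S y -> subring_gen S z -> subring_gen S (y - z)
| SubringGenM y z :
    subring_gen S y -> subring_gen S z -> subring_gen S (y * z).

Definition coefs_in (R : comNzRingType) (S : R -> Prop) (P : {poly R}) : Prop :=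
  forall k, S P`_k.

Definition transcendental_over (R : comNzRingType) (S : R -> Prop) (z : R) :=
  forall P : {poly R}, coefs_in S P -> P.[z] = 0 -> P = 0.

Definition minimal_relation (R : comNzRingType) (S : R -> Prop) (z : R)
    (P : {poly R}) : Prop :=
  [/\ P \is monic, coefs_in S P, P.[z] = 0
    & forall P' : {poly R}, coefs_in S P' -> P' != 0 -> P'.[z] = 0 ->
        (size P <= size P')%N].

(* The algebra S^* of the fractions g / h, g and h in S, h <> 0 homogeneous,  *)
(* inside gr nu, where such an h is invertible (homogeneous_init, init_unit). *)
Definition saturation (L : fieldType) (G : ordGroupType) (nu : valuation L G)
    (S : gr nu -> Prop) (z : gr nu) : Prop :=
  exists g h, [/\ S g, S h, homogeneous h, h <> 0 & z * h = g].

Notation exponents Lam := {fsfun Lam -> nat with 0%N}.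

Section Indices.
Variables (d : Order.disp_t) (Lam : bOrderType d).
Implicit Types (i j k q p l : Lam) (D : Lam -> Prop).
Local Open Scope order_scope.

Definition countable_type (T : Type) : Prop := exists f : T -> nat, injective f.

Definition well_ordered : Prop := well_founded (fun i j : Lam => i < j).

Definition is_max i : Prop := forall j, j <= i.

Definition succ i j : Prop := i < j /\ forall k, ~ (i < k < j).

(* k = i + t *)
Fixpoint shift i (t : nat) k : Prop :=
  if t is t'.+1 then exists2 j, shift i t' j & succ j k else k = i.

(* j = i + omega, the least upper bound of the i + t *)
Definition shift_omega i j : Prop :=
  (forall t, exists2 k, shift i t k & k < j) /\
  (forall k, k < j -> exists t, exists2 p, shift i t p & k <= p).

(* Below D is an initial segment of Lam, either the whole of Lam or           *)
(* {q | q <= l}; i+ is computed in D.                                         *)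
Definition whole : Lam -> Prop := fun=> True.
Definition upto l : Lam -> Prop := fun q => q <= l.

Variable alpha : Lam -> nat.

Definition inessential D i : Prop :=
  (exists2 j, D j & shift_omega i j) /\
  (forall t k, shift i t k -> alpha k = 1%N).

(* j = i+ *)
Definition next_index D i j : Prop :=
  D j /\ ((inessential D i /\ shift_omega i j) \/
          (~ inessential D i /\ succ i j)).

Definition std_exponents l (g : exponents Lam) : Prop :=
  [/\ forall q, g q <> 0%N -> q <= l,
      forall q p, q < l -> next_index (upto l) q p -> (g q < alpha p)%N
    & forall q p j k, inessential (upto l) q -> next_index (upto l) q p ->
        next_index (upto l) j p -> next_index (upto l) k p ->
        g j <> 0%N -> g k <> 0%N -> j = k].

End Indices.

Definition constf (K : fieldType) : {rmorphism K -> {fraction {poly K}}} :=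
  (@tofrac {poly K}) \o (@polyC K).

Section KeyPolynomials.
Variables (K : fieldType) (G : ordGroupType).
Variable nu : valuation {fraction {poly K}} G.
Variables (d : Order.disp_t) (Lam : bOrderType d).
Variables (alpha : Lam -> nat) (Q : Lam -> {poly K}).
Implicit Types (f g h : {poly K}) (i k q l : Lam) (C : seq {poly K}).

Definition nuK : valuation K G := vrestr (constf K) nu.

Definition pval f : option G := nu (tofrac f).

Definition pinit f : gr nu := init nu (tofrac f).

Definition degree f : nat := (size f).-1.

Definition pre_key : Prop :=
  [/\ alpha \bot%O = 1%N, forall i, (0 < alpha i)%N,
      forall i, Q i \is monic, Q \bot%O = 'X
    & forall i i0, ~ is_max i -> next_index alpha (@whole _ Lam) i0 i ->
        degree (Q i) = (alpha i * degree (Q i0))%N].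

(* A monomial c M, M = \prod_q (Q q)^(g q), is given by the pair (c, g).      *)
Definition power_product (g : exponents Lam) : {poly K} :=
  \prod_(q <- finsupp g) Q q ^+ g q.

Definition monomial (m : K * exponents Lam) : {poly K} :=
  m.1%:P * power_product m.2.

Definition free_std_monomial l (m : K * exponents Lam) : Prop :=
  std_exponents alpha l m.2 /\ m.2 l = 0%N.

Definition free_std_sum l (s : seq (K * exponents Lam)) : Prop :=
  (forall m, m \in s -> free_std_monomial l m) /\
  pval (\sum_(m <- s) monomial m) =
    \big[@emin G/None]_(m <- s) pval (monomial m).

Definition free_std_expansion l h : Prop :=
  exists2 s, free_std_sum l s & h = \sum_(m <- s) monomial m.

Definition expansion l C : {poly K} := \sum_(j < size C) C`_j * Q l ^+ j.

Definition std_expansion l g C : Prop :=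
  (forall c, c \in C -> free_std_expansion l c) /\ g = expansion l C.

Definition min_term l C : option G :=
  \big[@emin G/None]_(j < size C) pval (C`_j * Q l ^+ j).

(* the algebra G_{nu_K}[in_nu Q_q, q < i] *)
Definition init_algebra i : gr nu -> Prop :=
  subring_gen (fun z =>
    (exists y : gr nuK, z = gr_map (constf K) nu y) \/
    (exists2 q, (q < i)%O & z = pinit (Q q))).

(* s j is the list of the monomials of the coefficient of (Q k)^j *)
Definition successor_condition k i : Prop :=
  exists s : nat -> seq (K * exponents Lam),
    [/\ forall j, (j < alpha i)%N -> free_std_sum k (s j),
        Q i = Q k ^+ alpha i +
              \sum_(j < alpha i) (\sum_(m <- s j) monomial m) * Q k ^+ j,
        forall j m, (j < alpha i)%N -> m \in s j -> m.1 != 0 ->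
          pval (monomial m * Q k ^+ j) = pval (Q k ^+ alpha i)
      & minimal_relation (saturation (init_algebra k)) (pinit (Q k))
          ('X^(alpha i) +
           \sum_(j < alpha i)
             (\sum_(m <- s j)
                gr_map (constf K) nu (init nuK m.1) *
                pinit (power_product m.2)) *: 'X^j)].

(* The existence clause keeps the property from holding vacuously.            *)
Definition exceeds_expansions i g : Prop :=
  forall i0, next_index alpha (@whole _ Lam) i0 i ->
    (exists C, std_expansion i0 g C) /\
    (forall C, std_expansion i0 g C -> elt (min_term i0 C) (pval g)).

(* {beta_q | q < i} is bounded by an element g (x) 1/n of Gamma_0 (x) Q *)
Definition bounded_values_below i : Prop :=
  exists (g : G) n, [/\ value_group nuK g, (0 < n)%N
    & forall q, (q < i)%O -> ele (emuln (pval (Q q)) n) (Some g)].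

Definition limit_condition i : Prop :=
  [/\ exists i0, next_index alpha (@whole _ Lam) i0 i,
      forall i0, next_index alpha (@whole _ Lam) i0 i ->
        exists2 C, std_expansion i0 (Q i) C & size C = (alpha i).+1,
      exceeds_expansions i (Q i),
      forall g, exceeds_expansions i g -> (degree (Q i) <= degree g)%N
    & bounded_values_below i ->
      forall i0 C, next_index alpha (@whole _ Lam) i0 i ->
        std_expansion i0 (Q i) C -> size C = (alpha i).+1 ->
        [/\ C`_(alpha i) = 1,
            min_term i0 C = emuln (pval (Q i0)) (alpha i)
          & pval C`_0 = emuln (pval (Q i0)) (alpha i)]].

Definition key_polynomials : Prop :=
  [/\ pre_key,
      forall i b, ~ is_max i -> pval (Q i) = Some b ->
        in_divisible_hull (value_group nuK) b,
      forall k i, succ k i -> successor_condition k i,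
      forall i, i <> \bot%O -> (forall k, ~ succ k i) -> limit_condition i
    & forall n,
        ~ (exists s : seq Lam, forall i, degree (Q i) = n -> i \in s) ->
        forall f, f \is monic -> degree f = n ->
          exists2 i, degree (Q i) = n & ele (pval f) (pval (Q i))].

(* coefficients of the Q i-expansion of f, see qcoefE and size_qcoef *)
Definition qcoef i f (j : nat) : {poly K} := (f %/ Q i ^+ j) %% Q i.

Definition truncation i f : option G :=
  \big[@emin G/None]_(j < size f)
    eadd (pval (qcoef i f j)) (emuln (pval (Q i)) j).

Definition complete : Prop :=
  forall f, f != 0 -> exists i, truncation i f = pval f.

Lemma size_qcoef i f j : Q i != 0 -> (size (qcoef i f j) < size (Q i))%N.
Proof. exact: ltn_modpN0. Qed.

Lemma qcoefE i f : (1 < size (Q i))%N ->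
  f = \sum_(j < size f) qcoef i f j * Q i ^+ j.
Proof.
move=> hs; have Q0 : Q i != 0 by rewrite -size_poly_gt0 ltnW.
have rec n : f = (f %/ Q i ^+ n) * Q i ^+ n +
                 \sum_(j < n) qcoef i f j * Q i ^+ j.
  elim: n => [|n IHn]; first by rewrite big_ord0 expr0 divp1 mulr1 addr0.
  rewrite big_ord_recr /= addrA addrAC [LHS]IHn; congr (_ + _).
  rewrite /qcoef {1}[f %/ _](divp_eq _ (Q i)) mulrDl -mulrA -exprS.
  by rewrite divp_divl -exprSr.
have lt : (size f < size (Q i ^+ size f))%N.
  rewrite -(@prednK (size (Q i ^+ _))) ?size_poly_gt0 ?expf_neq0 //.
  rewrite ltnS size_exp -[X in (X <= _)%N]mul1n leq_mul //.
  by rewrite -ltnS prednK // ltnW.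
by rewrite [LHS](rec (size f)) divp_small // mul0r add0r.
Qed.

End KeyPolynomials.

Arguments pinit {K G} nu f.
Arguments init_algebra {K G} nu {d Lam} Q i z.

(* Main.v *)
Require Import Defs.
From HB Require Import structures.
From mathcomp Require Import all_boot all_order all_algebra.
From mathcomp Require Import fraction finmap zify.
From Stdlib Require Import Classical.

Set Implicit Arguments.
Unset Strict Implicit.
Unset Printing Implicit Defensive.

Import Order.TTheory GRing.Theory Num.Theory.
Local Open Scope ring_scope.

(* Every polynomial of degree smaller than deg Q_l has an l-standard expansion
   whose value is the minimum of the values of its monomials, by well-founded
   induction on l. At a successor l = k + 1, a cancellation in the Q_k-expansion
   would be an algebraic relation of in Q_k of degree < alpha_l, against the
   minimality in (b); at a limit, it would contradict the minimality of deg Q_l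
   in (c). Hence in h lies in G_{nu_K}[in Q_q, q < i] as soon as
   deg h < deg Q_i, and nu_i(f) < nu(f) would give a relation of in Q_i over
   this algebra. If i had a successor, clearing the denominators of the relation
   in (b) would give one too. *)

(** * Order and minima of values, the value of 0 included *)

Section ExtendedValues.
Variable G : ordGroupType.
Implicit Types a b c : option G.

Lemma ele_anti a b : ele a b -> ele b a -> a = b.
Proof.
by case: a b => [x|] [y|] //= xy yx; congr Some; apply: le_anti; rewrite xy.
Qed.

Lemma eltxx a : elt a a = false.
Proof. by rewrite /elt ele_refl. Qed.

Lemma elt_ele a b : elt a b -> ele a b.
Proof. by case: a b => [x|] [y|] //=; rewrite /elt /= -ord_ltNge => /ltW. Qed.

Lemma leD2r_ele a b c : ele a b -> ele (eadd a c) (eadd b c).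
Proof. by case: a b c => [x|] [y|] [z|] //= xy; rewrite leDD. Qed.

Lemma ele_bigemin c I (r : seq I) (F : I -> option G) :
  ele c (\big[@emin G/None]_(j <- r) F j) = all (fun j => ele c (F j)) r.
Proof.
elim: r => [|j r IHr]; first by rewrite big_nil; case: c.
by rewrite big_cons ele_emin IHr.
Qed.

(** The condition on [c] is for the empty list, whose minimum [None] does not exceed itself. *)
Lemma elt_bigemin c I (r : seq I) (F : I -> option G) : c <> None ->
  elt c (\big[@emin G/None]_(j <- r) F j) = all (fun j => elt c (F j)) r.
Proof.
move=> c0; elim: r => [|j r IHr]; first by rewrite big_nil; case: c c0.
by rewrite big_cons elt_emin IHr.
Qed.

End ExtendedValues.

(** * Values and initial forms of finite sums *)

Section ValuesOfSums.
Variables (L : fieldType) (G : ordGroupType) (nu : valuation L G).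

(** For [y = 0] and [n = 0] the two sides differ: [emuln None 0] is [None], whereas [nu 1] is
    [Some 0]. *)
Lemma valuationX y n : y != 0 -> nu (y ^+ n) = emuln (nu y) n.
Proof.
move=> y0; elim: n => [|n IHn].
  rewrite valuation1; case e: (nu y) => //.
  by move/valuation_None/eqP: e; rewrite (negPf y0).
by rewrite exprS valuationM IHn; case: (nu y) => //= b; rewrite mulrS.
Qed.

Lemma bigemin_le_sum I (r : seq I) (F : I -> L) :
  ele (\big[@emin G/None]_(j <- r) nu (F j)) (nu (\sum_(j <- r) F j)).
Proof.
elim: r => [|j r IHr]; first by rewrite !big_nil valuation0.
rewrite !big_cons; apply: ele_trans (valuationD _ _ _).
rewrite ele_emin /emin; case: ifPn => h; first by rewrite ele_refl (ele_trans h).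
by rewrite IHr andbT; exact: elt_ele.
Qed.

(** The minimum of the values of the terms is always a lower bound for the value of the sum, so only
    the reverse inequality matters. Its termwise form is the one established and used below. *)
Lemma valuation_sum_min I (r : seq I) (F : I -> L) :
  all (fun j => ele (nu (\sum_(j <- r) F j)) (nu (F j))) r <->
  nu (\sum_(j <- r) F j) = \big[@emin G/None]_(j <- r) nu (F j).
Proof.
rewrite -(ele_bigemin _ _ (fun j => nu (F j))); split=> [h|->]; last exact: ele_refl.
by apply: ele_anti => //; exact: bigemin_le_sum.
Qed.

Lemma grcls0 b : grcls nu b 0 = 0.
Proof. by apply/grcls_eq0; rewrite valuation0. Qed.

Lemma grcls_init b y : ele (Some b) (nu y) ->
  grcls nu b y = if nu y == Some b then init nu y else 0.
Proof.
move=> h; case: eqP => [e|ne]; first by rewrite (init_cls e).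
apply/grcls_eq0 => //; apply/negP => h'; apply: ne; exact: ele_anti.
Qed.

Lemma grcls_sum b I (r : seq I) (F : I -> L) :
  all (fun j => ele (Some b) (nu (F j))) r ->
  grcls nu b (\sum_(j <- r) F j) = \sum_(j <- r) grcls nu b (F j).
Proof.
elim: r => [|j r IHr] /=; first by rewrite !big_nil grcls0.
case/andP=> hj hr; rewrite !big_cons grclsD ?IHr //.
apply: ele_trans (bigemin_le_sum r F).
by rewrite (ele_bigemin _ _ (fun j => nu (F j))).
Qed.

Lemma initX y n : init nu (y ^+ n) = init nu y ^+ n.
Proof. by elim: n => [|n IHn]; rewrite ?init1 // !exprS initM IHn. Qed.

Lemma init_prod I (r : seq I) (F : I -> L) :
  init nu (\prod_(j <- r) F j) = \prod_(j <- r) init nu (F j).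
Proof. exact: (big_morph _ (initM nu) (init1 nu)). Qed.

(* The relation is the initial part of [\sum_j d j * y ^+ j], which cancels. *)
Lemma init_relation (S : gr nu -> Prop) (n : nat) (d : nat -> L) (y : L) :
  S 0 -> (forall j, (j < n)%N -> S (init nu (d j))) ->
  ~~ all (fun j : 'I_n => ele (nu (\sum_(j < n) d j * y ^+ j))
                             (nu (d j * y ^+ j))) (index_enum 'I_n) ->
  exists P : {poly gr nu},
    [/\ coefs_in S P, P != 0, (size P <= n)%N & P.[init nu y] = 0].
Proof.
move=> S0 Sd; rewrite -(ele_bigemin _ _ (fun j : 'I_n => nu (d j * y ^+ j))).
set m := \big[_/_]_(_ <- _) _ => mlt.
case em: m mlt => [b|]; last by case: (nu _).
move=> blt; have hall : all (fun j : 'I_n => ele (Some b) (nu (d j * y ^+ j)))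
    (index_enum 'I_n).
  by rewrite -(ele_bigemin _ _ (fun j : 'I_n => nu (d j * y ^+ j))) -/m em ele_refl.
(* [b] is the least value of a term. Evaluated at [init nu y], [P] gives the class of the sum in
   degree [b], which is 0 because the sum has larger value. *)
pose P := \poly_(j < n) (if nu (d j * y ^+ j) == Some b then init nu (d j) else 0).
exists P; split.
- by move=> k; rewrite coef_poly; case: ifP => // kn; case: ifP => // _; apply: Sd.
(* Were [P] zero, no term could attain [b], since a term of finite value has a nonzero coefficient;
   the minimum [m] would then exceed [b]. *)
- apply/negP => /eqP P0; have : elt (Some b) m; last by rewrite em eltxx.
  rewrite /m elt_bigemin //; apply/allP => j _; apply/negP => lejb.
  have ej : nu (d j * y ^+ j) = Some b.
    by apply: ele_anti => //; apply: (allP hall); rewrite mem_index_enum.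
  have /(congr1 (fun p : {poly _} => p`_j)) := P0.
  rewrite coef_poly ltn_ord ej eqxx coef0 => /init_eq0 dj0.
  by move: ej; rewrite dj0 mul0r valuation0.
- exact: size_poly.
- have h : grcls nu b (\sum_(j < n) d j * y ^+ j) = 0.
    by apply/grcls_eq0; [apply: elt_ele|].
  rewrite horner_poly -[RHS]h grcls_sum //; apply: eq_bigr => j _.
  rewrite grcls_init; last by apply: (allP hall); rewrite mem_index_enum.
  by case: ifP => _; rewrite ?mul0r // initM initX.
Qed.

End ValuesOfSums.

(** * Subrings generated by a set *)

Section GeneratedSubrings.
Variables (R : comNzRingType) (T : R -> Prop).
Local Notation S := (subring_gen T).

Lemma subring_gen0 : S 0.
Proof. by rewrite -(subrr 1); apply: SubringGenB; apply: SubringGen1. Qed.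

Lemma subring_genD y z : S y -> S z -> S (y + z).
Proof.
move=> Sy Sz; rewrite -[z]opprK; apply: SubringGenB => //.
by rewrite -sub0r; apply: SubringGenB => //; apply: subring_gen0.
Qed.

Lemma subring_gen_sum (I : eqType) (r : seq I) (F : I -> R) :
  (forall j, j \in r -> S (F j)) -> S (\sum_(j <- r) F j).
Proof.
move=> h; rewrite big_seq; apply: (big_ind S) => //.
  exact: subring_gen0.
exact: subring_genD.
Qed.

Lemma subring_gen_prod (I : eqType) (r : seq I) (F : I -> R) :
  (forall j, j \in r -> S (F j)) -> S (\prod_(j <- r) F j).
Proof.
move=> h; rewrite big_seq; apply: (big_ind S) => //.
  exact: SubringGen1.
exact: SubringGenM.
Qed.

Lemma subring_genX y n : S y -> S (y ^+ n).
Proof.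
move=> Sy; elim: n => [|n IHn]; first exact: SubringGen1.
by rewrite exprS; apply: SubringGenM.
Qed.

Lemma subring_gen_mono (T' : R -> Prop) z :
  (forall y, T y -> T' y) -> S z -> subring_gen T' z.
Proof.
move=> h; elim=> [y /h| |y y' _ IHy _ IHy'|y y' _ IHy _ IHy'].
- exact: SubringGen.
- exact: SubringGen1.
- exact: SubringGenB.
- exact: SubringGenM.
Qed.

End GeneratedSubrings.

(** * Initial forms and fractions over a generated subring *)

Section Saturation.
Variables (L : fieldType) (G : ordGroupType) (nu : valuation L G).
Variable T : gr nu -> Prop.
Local Notation S := (subring_gen T).

(** Without cancellation, the initial form of a sum is the sum of the initial forms of its terms of
    least value. *)
Lemma init_sum_subring_gen (I : eqType) (r : seq I) (F : I -> L) :
  all (fun j => ele (nu (\sum_(j <- r) F j)) (nu (F j))) r ->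
  (forall j, j \in r -> S (init nu (F j))) ->
  S (init nu (\sum_(j <- r) F j)).
Proof.
move=> hall hS; case e: (nu (\sum_(j <- r) F j)) => [b|]; last first.
  by rewrite /init e; apply: subring_gen0.
rewrite e in hall; rewrite (init_cls e) grcls_sum //.
apply: subring_gen_sum => j jr; rewrite grcls_init ?(allP hall) //.
by case: ifP => _; [apply: hS | apply: subring_gen0].
Qed.

Lemma sub_saturation z : S z -> saturation S z.
Proof.
move=> Sz; exists z, 1; split=> //; last by rewrite mulr1.
- exact: SubringGen1.
- exists 0, 1; rewrite valuation1 /=; split=> //.
  by rewrite -(init1 nu) (init_cls (valuation1 nu)).
- exact/eqP/oner_neq0.
Qed.

(** A nonzero homogeneous element of [gr nu] is an initial form, hence a unit, so the product of the
    finitely many denominators is a unit [h]. Its inverse [h'] is recorded because it later shows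
    that [h *: P] is nonzero. *)
Lemma clear_denominators (P : {poly gr nu}) : coefs_in (saturation S) P ->
  exists h h', [/\ S h, h * h' = 1 & coefs_in S (h *: P)].
Proof.
move=> hP; suff [h [h' [Sh hh' hn]]] : exists h h', [/\ S h, h * h' = 1
    & forall k, (k < size P)%N -> S (h * P`_k)].
  exists h, h'; split=> // k; rewrite coefZ.
  have [/hn //|sk] := ltnP k (size P).
  by rewrite nth_default // mulr0; apply: subring_gen0.
elim: (size P) => [|n [h [h' [Sh hh' hn]]]].
  by exists 1, 1; split=> //; [apply: SubringGen1 | rewrite mulr1].
have [g [e [Sg Se he e0 Pe]]] := hP n.
have [y y0 ey] := homogeneous_init he e0.
exists (h * e), (h' * init nu y^-1); split.
- exact: SubringGenM.
- by rewrite mulrACA hh' ey init_unit // mulr1.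
- move=> k; rewrite ltnS leq_eqVlt => /orP[/eqP ->|/hn Sk].
    by rewrite -mulrA [e * _]mulrC Pe; apply: SubringGenM.
  by rewrite mulrAC; apply: SubringGenM.
Qed.

End Saturation.

(** * Successors, limits [i + omega] and the operation [i+] on indices *)

Section Indices.
Variables (d : Order.disp_t) (Lam : bOrderType d) (alpha : Lam -> nat).
Implicit Types (i j k q p l : Lam) (D : Lam -> Prop).
Local Open Scope order_scope.

Lemma well_ordered_least (P : Lam -> Prop) : well_ordered Lam ->
  (exists i, P i) -> exists2 i, P i & forall j, P j -> i <= j.
Proof.
move=> wo [i Pi]; apply: NNPP => none; move: Pi; elim/(well_founded_ind wo): i.
move=> i IHi Pi; apply: none; exists i => // j Pj.
by rewrite leNgt; apply/negP => /IHi; apply.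
Qed.

Lemma exists_succ i k : well_ordered Lam -> i < k -> exists j, succ i j.
Proof.
move=> wo ik; have [|j ij jmin] := @well_ordered_least (fun j => i < j) wo.
  by exists k.
exists j; split=> // q /andP[iq]; rewrite ltNge => /negP; apply; exact: jmin.
Qed.

Lemma succ_le i j k : succ i j -> i < k -> j <= k.
Proof.
by case=> _ none ik; rewrite leNgt; apply/negP => kj; apply: (none k); rewrite ik.
Qed.

Lemma le_succ i j k : succ i j -> k < j -> k <= i.
Proof.
by case=> _ none kj; rewrite leNgt; apply/negP => ik; apply: (none k); rewrite kj ik.
Qed.

Lemma succ_inj i j k : succ i j -> succ i k -> j = k.
Proof.
by move=> sj sk; apply: le_anti; rewrite (succ_le sj sk.1) (succ_le sk sj.1).
Qed.

Lemma shift_inj i t j k : shift i t j -> shift i t k -> j = k.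
Proof.
elim: t j k => [|t IHt] j k /= => [-> -> //|[p ip pj] [q iq qk]].
by apply: (@succ_inj p) => //; rewrite (IHt _ _ ip iq).
Qed.

Lemma shift_shift i s t j k : shift i s j -> shift j t k -> shift i (s + t)%N k.
Proof.
move=> sj; elim: t k => [|t IHt] k /=; first by move=> ->; rewrite addn0.
by case=> p jp pk; rewrite addnS; exists p => //; apply: IHt.
Qed.

Lemma shift_cofinal i t k p : shift i t p -> i <= k -> k <= p ->
  exists s, shift i s k.
Proof.
elim: t p => [|t IHt] p /=.
  by move=> -> ik ki; exists 0%N; apply: le_anti; rewrite ik ki.
case=> q iq qp ik; rewrite le_eqVlt => /orP[/eqP ->|kp].
  by exists t.+1, q.
by apply: (IHt q) => //; apply: le_succ kp.
Qed.

Lemma shift_omega_gt q p : shift_omega q p -> q < p.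
Proof. by case=> /(_ 0%N) [k /= ->]. Qed.

Lemma shift_omega_between q p k : shift_omega q p -> q <= k -> k < p ->
  exists t, shift q t k.
Proof. by case=> _ h qk /h [t [r qr kr]]; exact: shift_cofinal qr qk kr. Qed.

(** Dropping the first [t] terms of the sequence [q], [q + 1], ... leaves its least upper bound
    unchanged. *)
Lemma shift_omega_shift q p k t :
  shift_omega q p -> shift q t k -> shift_omega k p.
Proof.
case=> hlt hcof qk; have shk s r : shift q (t + s)%N r -> shift k s r.
  elim: s r => [|s IHs] r; first by rewrite addn0 => /(shift_inj qk).
  by rewrite addnS => -[r' /IHs ? ?]; exists r'.
split=> [s|r rp].
  by have [r qr rp] := hlt (t + s)%N; exists r => //; apply: shk.
have [s [r' qr rr']] := hcof _ rp; have [r'' qr'' _] := hlt (t + s)%N.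
(* [r'] is [q + s] and [r''] is [k + s = q + t + s], so [r'] lies below [r'']. *)
exists s, r''; first exact: shk.
apply: le_trans rr' _; rewrite addnC in qr''.
elim: t r'' qr'' {qk shk} => [|n IHn] r''.
  by rewrite addn0 => /(shift_inj qr) ->.
by rewrite addnS => -[u /IHn r'u [ur _]]; apply: le_trans r'u (ltW ur).
Qed.

(** A predecessor [k] of [p] would lie below some [q + t], and [q + t + 1] would then fall strictly
    between [k] and [p]. *)
Lemma shift_omega_nsucc q p k : shift_omega q p -> ~ succ k p.
Proof.
case=> hlt hcof sk; have [t [r qr kr]] := hcof _ sk.1.
have [r' [u qu ur'] r'p] := hlt t.+1; rewrite -(shift_inj qr qu) in ur'.
by have := le_lt_trans (le_succ sk r'p) (le_lt_trans kr ur'.1); rewrite ltxx.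
Qed.

Lemma shift_omega_le q p p' : shift_omega q p -> shift_omega q p' -> p <= p'.
Proof.
move=> [_ hcof] [hlt _]; rewrite leNgt; apply/negP => /hcof [t [r qr p'r]].
have [r' qr' r'p'] := hlt t; rewrite (shift_inj qr qr') in p'r.
by have := lt_le_trans r'p' p'r; rewrite ltxx.
Qed.

Lemma shift_omega_inj q p p' : shift_omega q p -> shift_omega q p' -> p = p'.
Proof. by move=> h h'; apply: le_anti; rewrite !(@shift_omega_le q). Qed.

Lemma inessential_shift D q k t :
  inessential alpha D q -> shift q t k -> inessential alpha D k.
Proof.
move=> [[p Dp qp] h1] qk; split=> [|s r kr]; last exact: h1 (shift_shift qk kr).
by exists p => //; apply: shift_omega_shift qk.
Qed.

Lemma inessential_sub D D' q : (forall k, D k -> D' k) ->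
  inessential alpha D q -> inessential alpha D' q.
Proof. by move=> DD' [[p Dp qp] h1]; split=> //; exists p => //; apply: DD'. Qed.

Lemma inessential_upto_le l l' q : l <= l' ->
  inessential alpha (upto l) q -> inessential alpha (upto l') q.
Proof. by move=> ll'; apply: inessential_sub => k kl; apply: le_trans ll'. Qed.

Lemma next_index_gt D q p : next_index alpha D q p -> q < p.
Proof. by case=> _ [[_ /shift_omega_gt]|[_ []]]. Qed.

Lemma next_index_inj D q p p' :
  next_index alpha D q p -> next_index alpha D q p' -> p = p'.
Proof.
case=> _ [[iq h]|[niq h]] [_ [[iq' h']|[niq' h']]] //.
  exact: shift_omega_inj h h'.
exact: succ_inj h h'.
Qed.

Lemma next_index_limit D q p k : shift_omega k p -> next_index alpha D q p ->
  inessential alpha D q /\ shift_omega q p.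
Proof. by move=> hk [_ [//|[_ /(shift_omega_nsucc hk)]]]. Qed.

(** The segment enters the notion of an inessential index only through the presence of [q + omega],
    so [q+] is the same in every segment that contains this limit. *)
Lemma next_index_limitI D D' q p : shift_omega q p -> inessential alpha D q ->
  D' p -> next_index alpha D' q p.
Proof.
move=> qp iq Dp; split=> //; left; split=> //; case: iq => _ h1; split=> //.
by exists p.
Qed.

Lemma next_index_succ l q p : succ q p -> p <= l -> ~ inessential alpha (upto l) q ->
  next_index alpha (upto l) q p.
Proof. by move=> qp pl nq; split=> //; right. Qed.

Lemma exists_next_index l q : well_ordered Lam -> q < l ->
  exists p, next_index alpha (upto l) q p.
Proof.
move=> wo ql; have [iq|niq] := classic (inessential alpha (upto l) q).
  by case: (iq) => -[p pl qp] _; exists p; apply: next_index_limitI iq _.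
have [p qp] := exists_succ wo ql.
by exists p; apply: next_index_succ (succ_le _ ql) _.
Qed.

Lemma next_index_limit_between D q p k : shift_omega q p ->
  inessential alpha D q -> q <= k -> k < p -> next_index alpha D k p.
Proof.
move=> qp iq qk kp; have [t qtk] := shift_omega_between qp qk kp.
apply: (@next_index_limitI D); first exact: shift_omega_shift qtk.
  exact: inessential_shift qtk.
by case: iq => -[p' Dp' qp'] _; rewrite (shift_omega_inj qp qp').
Qed.

Lemma next_index_pred_limit l q p j : inessential alpha (upto l) q ->
  next_index alpha (upto l) q p -> next_index alpha (upto l) j p ->
  inessential alpha (upto l) j /\ shift_omega j p.
Proof.
by move=> iq [_ [[_ qp]|[]//]]; exact: next_index_limit qp.
Qed.

End Indices.

(** * Standard exponents when the level changes *)

Section StandardExponents.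
Variables (d : Order.disp_t) (Lam : bOrderType d) (alpha : Lam -> nat).
Implicit Types (k q p l : Lam) (g : exponents Lam).
Hypothesis wo : well_ordered Lam.
Hypothesis alpha_gt0 : forall q, (0 < alpha q)%N.
Local Open Scope order_scope.

(* As q + omega > k, the index q is not inessential in {r | r <= k}, so there
   q+ = q + 1 and the exponent of Q_q is less than alpha_(q+1) = 1. *)
Lemma std_exponents_vanish k q p g : std_exponents alpha k g ->
  shift_omega q p -> (forall t r, shift q t r -> alpha r = 1%N) ->
  q < k -> k < p -> g q = 0%N.
Proof.
move=> [_ hlt _] qp h1 qk kp.
have [r qr] := exists_succ wo qk.
have /(hlt _ _ qk) : next_index alpha (upto k) q r.
  apply: next_index_succ => //; first exact: succ_le qk.
  case=> -[p' p'k qp'] _.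
  by have := le_lt_trans p'k kp; rewrite (shift_omega_inj qp qp') ltxx.
by rewrite (h1 1%N) ?ltnS ?leqn0 => [/eqP|]; last by exists q.
Qed.

(** Passing from level [k] to level [l = k+] changes [q+] only for those [q < k] whose [q + omega]
    lies above [k]. Their exponents vanish, so the new exponent [j] at [k] breaks neither the bounds
    nor the uniqueness. *)
Lemma std_exponents_with l k j g : next_index alpha (upto l) k l ->
  std_exponents alpha k g -> g k = 0%N -> (j < alpha l)%N ->
  std_exponents alpha l [fsfun g with k |-> j] /\ [fsfun g with k |-> j] l = 0%N.
Proof.
move=> kl gstd gk jl; have ltkl := next_index_gt kl.
have [gsupp gltn guniq] := gstd.
have outk q : k < q -> g q = 0%N.
  by move=> kq; apply/eqP/negP => /negP/eqP /gsupp; rewrite leNgt kq.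
split; last by rewrite fsfun_withE gt_eqF //; apply: outk.
split.
- move=> q; rewrite fsfun_withE; case: eqP => [-> _|_ /gsupp qk]; first exact: ltW.
  exact: le_trans (ltW ltkl).
- move=> q p ql qp; rewrite fsfun_withE; case: eqP => [qk|/eqP qk].
    by rewrite qk in qp; rewrite (next_index_inj qp kl).
  have [kq|] := ltP k q; first by rewrite outk.
  rewrite le_eqVlt (negPf qk) /= => ltqk.
  case: (qp) => pl [[iq qp']|[niq qp']].
    have [pk|kp] := leP p k; first by apply: gltn (next_index_limitI qp' iq _).
    by rewrite (std_exponents_vanish gstd qp') // => t r; case: iq => _; apply.
  apply: gltn => //; apply: next_index_succ => //; first exact: succ_le ltqk.
  by apply: contra_not niq; apply: inessential_upto_le; apply: ltW.
- move=> q p j1 j2 iq qp j1p j2p.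
  have [i1 s1] := next_index_pred_limit iq qp j1p.
  have [i2 s2] := next_index_pred_limit iq qp j2p.
  have [_ sq] := next_index_pred_limit iq qp qp.
  have [pk|kp] := leP p k.
    have ne j' : j' < p -> j' != k.
      by move=> j'p; rewrite lt_eqF // (lt_le_trans j'p).
    rewrite !fsfun_withE (negPf (ne _ (shift_omega_gt s1))).
    rewrite (negPf (ne _ (shift_omega_gt s2))) => g1 g2.
    have I q' : inessential alpha (upto l) q' -> shift_omega q' p ->
        inessential alpha (upto k) q'.
      by move=> [_ h1] q'p; split=> //; exists p.
    apply: (guniq q p) => //; first exact: I.
    + exact: next_index_limitI sq iq _.
    + exact: next_index_limitI s1 i1 _.
    + exact: next_index_limitI s2 i2 _.
  (* With [p] above [k], every index other than [k] whose limit is [p] has exponent 0. *)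
  suff onlyk j' : inessential alpha (upto l) j' -> shift_omega j' p ->
      [fsfun g with k |-> j] j' <> 0%N -> j' = k.
    by move=> g1 g2; rewrite (onlyk j1) // (onlyk j2).
  move=> ij' j'p; rewrite fsfun_withE; case: eqP => // /eqP j'k.
  have [kj'|] := ltP k j'; first by rewrite outk.
  rewrite le_eqVlt (negPf j'k) /= => ltj'k.
  by rewrite (std_exponents_vanish gstd j'p) // => t r; case: ij' => _; apply.
Qed.

(** Cutting down to level [q] can make an index [p < q] lose the property of being inessential,
    which tightens the bound on [g p]. Then [p] and [q] have the same limit at level [l], and as
    [g q] is nonzero, uniqueness there forces [g p = 0]. *)
Lemma std_exponents_without l q g : std_exponents alpha l g -> q < l ->
  g q <> 0%N -> (forall p, q < p -> g p = 0%N) ->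
  std_exponents alpha q [fsfun g with q |-> 0%N].
Proof.
move=> [gsupp gltn guniq] ql gq0 gout; split.
- move=> p; rewrite fsfun_withE; case: eqP => // _ gp.
  by rewrite leNgt; apply/negP => /gout.
- move=> p r pq pr; rewrite fsfun_withE lt_eqF //.
  have pl := lt_trans pq ql.
  have [->//|/eqP gp0] := eqVneq (g p) 0%N.
  case: (pr) => rq [[ip spr]|[nip spr]].
    apply: gltn => //; apply: next_index_limitI ip _ => //.
    exact: le_trans (ltW ql).
  have [ip|nip'] := classic (inessential alpha (upto l) p); last first.
    by apply: gltn => //; apply: next_index_succ => //; apply: le_trans (ltW ql).
  have [[u ul pu] h1] := ip; have [uq|qu] := leP u q.
    by case: nip; split=> //; exists u.
  have nq := next_index_limit_between pu ip (ltW pq) qu.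
  have np := next_index_limit_between pu ip (lexx p) (lt_trans pq qu).
  by have e := guniq p u p q ip np np nq gp0 gq0; rewrite e ltxx in pq.
- move=> p r j1 j2 ip pr j1r j2r.
  have [i1 s1] := next_index_pred_limit ip pr j1r.
  have [i2 s2] := next_index_pred_limit ip pr j2r.
  have [_ s] := next_index_pred_limit ip pr pr.
  have rq : r <= q by case: pr.
  have rl := le_trans rq (ltW ql).
  rewrite !fsfun_withE !lt_eqF ?(lt_le_trans (shift_omega_gt s1)) //;
    last exact: lt_le_trans (shift_omega_gt s2) _.
  apply: (guniq p r).
  + by apply: inessential_upto_le ip; apply: ltW.
  + exact: next_index_limitI s ip _.
  + exact: next_index_limitI s1 i1 _.
  + exact: next_index_limitI s2 i2 _.
Qed.

Lemma std_exponents0 l : std_exponents alpha l [fsfun for fun=> 0%N].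
Proof. by split=> [q|q p _ _|q p j k _ _ _ _]; rewrite fsfun0E. Qed.

End StandardExponents.

(** * Degrees of polynomials and expansions in powers of one of them *)

Lemma scale_monic_neq0 (R : comNzRingType) (h h' : R) (P : {poly R}) :
  h * h' = 1 -> P \is monic -> h *: P <> 0.
Proof.
move=> hh' /monicP mP /(congr1 (fun p : {poly R} => p`_(size P).-1)).
rewrite coefZ -lead_coefE mP mulr1 coef0 => h0.
by move: hh'; rewrite h0 mul0r => /esym/eqP; rewrite oner_eq0.
Qed.

Lemma size_Xn_add_lower (R : nzRingType) n (c : nat -> R) :
  size ('X^n + \sum_(j < n) c j *: 'X^j) = n.+1.
Proof.
rewrite size_polyDl size_polyXn // ltnS.
apply: leq_trans (size_sum _ _ _) _; apply/bigmax_leqP => j _.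
by apply: leq_trans (size_scale_leq _ _) _; rewrite size_polyXn.
Qed.

Section Expansions.
Variable K : fieldType.
Implicit Types (p q f : {poly K}) (c : nat -> {poly K}).

Lemma size_monic p : p \is monic -> size p = (degree p).+1.
Proof. by move=> mp; rewrite /degree prednK // size_poly_gt0 monic_neq0. Qed.

Lemma degreeM p q : p \is monic -> q \is monic ->
  degree (p * q) = (degree p + degree q)%N.
Proof.
by move=> mp mq; rewrite /degree size_mul ?monic_neq0 // !size_monic // addSn addnS.
Qed.

Lemma degreeX p n : degree (p ^+ n) = (n * degree p)%N.
Proof. by rewrite /degree size_exp mulnC. Qed.

Lemma size_sum_expansion q n c : q \is monic ->
  (forall j, (j < n)%N -> (size (c j) < size q)%N) ->
  (size (\sum_(j < n) c j * q ^+ j)%R < size (q ^+ n)%R)%N.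
Proof.
move=> mq; elim: n => [|n IHn] hc; first by rewrite big_ord0 size_poly0 size_poly1.
have mqn := monic_exp n mq.
have qn : (size (q ^+ n.+1) = degree q + size (q ^+ n)%R)%N.
  by rewrite !size_monic ?monic_exp // !degreeX mulSn addnS.
rewrite big_ord_recr /=; apply: leq_ltn_trans (size_polyD _ _) _.
rewrite gtn_max qn ltn_addl ?IHn //=; last by move=> j jn; rewrite hc // ltnW.
have := hc n (leqnn _); rewrite (size_monic mq) => cn.
apply: leq_ltn_trans (size_polyMleq _ _) _.
rewrite (size_monic mqn) addnS /= addnS ltnS leq_add2r; exact: cn.
Qed.

(** Each division by [q] strips off the lowest coefficient; this yields the uniqueness of the
    expansion. *)
Lemma expansion_coef q n c j : q != 0 ->
  (forall j, (j < n)%N -> (size (c j) < size q)%N) ->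
  ((\sum_(k < n) c k * q ^+ k) %/ q ^+ j) %% q = if (j < n)%N then c j else 0.
Proof.
move=> q0; elim: n c j => [|n IHn] c j hc.
  by rewrite big_ord0 div0p mod0p.
have E : \sum_(k < n.+1) c k * q ^+ k =
         (\sum_(k < n) c k.+1 * q ^+ k) * q + c 0%N.
  rewrite big_ord_recl expr0 mulr1 addrC; congr (_ + _).
  by rewrite mulr_suml; apply: eq_bigr => k _; rewrite exprSr mulrA.
rewrite E; case: j => [|j]; first by rewrite expr0 divp1 modp_addl_mul_small ?hc.
rewrite exprS -divp_divl divp_addl_mul_small ?hc // ltnS.
by rewrite (IHn (fun k => c k.+1)) // => k kn; rewrite hc.
Qed.

(** After [n] divisions the leftover quotient vanishes by degree. The length [n] is free so that it
    can be [alpha i] at a successor index. *)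
Lemma expansion_sum q n f : (size f < size (q ^+ n)%R)%N ->
  f = \sum_(j < n) ((f %/ q ^+ j) %% q) * q ^+ j.
Proof.
have rec m : f = (f %/ q ^+ m) * q ^+ m +
    \sum_(j < m) ((f %/ q ^+ j) %% q) * q ^+ j.
  elim: m => [|m IHm]; first by rewrite big_ord0 expr0 divp1 mulr1 addr0.
  rewrite big_ord_recr /= addrA addrAC [LHS]IHm; congr (_ + _).
  by rewrite {1}[f %/ _](divp_eq _ q) mulrDl -mulrA -exprS divp_divl -exprSr.
by move=> lt; rewrite [LHS](rec n) divp_small // mul0r add0r.
Qed.

End Expansions.

(** * Products of powers of a family of polynomials *)

Section PowerProducts.
Variables (K : fieldType) (d : Order.disp_t) (Lam : bOrderType d).
Variable Q : Lam -> {poly K}.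
Implicit Types (g : exponents Lam) (k q : Lam).

Lemma power_product_sup (D : {fset Lam}) g : (finsupp g `<=` D)%fset ->
  power_product Q g = \prod_(q <- D) Q q ^+ g q.
Proof.
by move=> gD; apply: big_fset_incl => // q _ /fsfun_dflt ->.
Qed.

(** Keeping one power on each side avoids division: [j = 0] removes the factor at [k], while
    [g k = 0] inserts one. *)
Lemma power_product_with g k j :
  Q k ^+ g k * power_product Q [fsfun g with k |-> j] =
  Q k ^+ j * power_product Q g.
Proof.
pose D := (k |` finsupp g)%fset; have kD : k \in D by rewrite !inE eqxx.
rewrite (power_product_sup (fsubsetUr _ _ : (_ `<=` D)%fset)).
rewrite (@power_product_sup D [fsfun g with k |-> j]); last first.
    apply/fsubsetP => q; rewrite mem_finsupp fsfun_withE !inE mem_finsupp.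
  by case: (q == k); rewrite ?orbT.
rewrite !(big_fsetD1 k kD) /= fsfun_with mulrCA; congr (_ * (_ * _)).
apply: eq_fbigr => q; rewrite !inE => /andP[qk _] _.
by rewrite fsfun_withE (negPf qk).
Qed.

Lemma power_product0 g : (forall q, g q = 0%N) -> power_product Q g = 1.
Proof. by move=> g0; rewrite /power_product big1 // => q _; rewrite g0. Qed.

Lemma power_product_monic g : (forall q, Q q \is monic) ->
  power_product Q g \is monic.
Proof. by move=> mQ; apply: rpred_prod => q _; apply: monic_exp. Qed.

Lemma exponents_max g q : g q <> 0%N ->
  exists2 p, g p <> 0%N & forall r, (p < r)%O -> g r = 0%N.
Proof.
have maxP (s : seq Lam) : s != [::] ->
    exists2 p, p \in s & forall r, r \in s -> (r <= p)%O.
  elim: s => // a [_ _|b s /(_ isT) [p ps hp] _].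
    by exists a; rewrite ?mem_head // => r; rewrite inE => /eqP ->.
  have [ap|pa] := leP a p.
    by exists p => [|r]; rewrite inE; [rewrite ps orbT | case/orP=> [/eqP ->|/hp]].
  exists a => [|r]; rewrite inE ?eqxx //; case/orP=> [/eqP ->//|/hp rp].
  exact: le_trans (ltW pa).
move/eqP; rewrite -mem_finsupp => qg.
have [|p pg hp] := maxP (finsupp g).
  by apply/eqP => e0; move: (qg : q \in enum_fset _); rewrite e0.
exists p => [|r pr]; first by apply/eqP; rewrite -mem_finsupp.
by apply: fsfun_dflt; apply/negP => /hp; rewrite leNgt pr.
Qed.

End PowerProducts.

(** * Key polynomials: immediate consequences of the conditions *)

Section KeyPolynomials.
Variables (K : fieldType) (G : ordGroupType).
Variable nu : valuation {fraction {poly K}} G.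
Variables (d : Order.disp_t) (Lam : bOrderType d).
Variables (alpha : Lam -> nat) (Q : Lam -> {poly K}).
Hypothesis wo : well_ordered Lam.
Hypothesis Q_key : key_polynomials nu alpha Q.
Implicit Types (f h : {poly K}) (i k q l : Lam) (g : exponents Lam).
Implicit Types (C : nat -> {poly K}).

Local Notation whole := (@whole d Lam).
Local Notation free_std := (free_std_expansion nu alpha Q).

Lemma key_alpha_gt0 q : (0 < alpha q)%N.
Proof. by case: Q_key => -[]. Qed.

Lemma key_monic q : Q q \is monic.
Proof. by case: Q_key => -[]. Qed.

Lemma key_neq0 q : Q q != 0.
Proof. exact: monic_neq0 (key_monic q). Qed.

Lemma key_bot : Q \bot%O = 'X.
Proof. by case: Q_key => -[]. Qed.

Lemma nonmax q l : (q < l)%O -> ~ is_max q.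
Proof. by move=> ql /(_ l); rewrite leNgt ql. Qed.

Lemma nonmax_le q l : (q <= l)%O -> ~ is_max l -> ~ is_max q.
Proof. by move=> ql nl mq; apply: nl => j; apply: le_trans ql. Qed.

Lemma index_cases l :
  [\/ l = \bot%O, exists k, succ k l
    | l <> \bot%O /\ forall k, ~ succ k l].
Proof.
have [->|/eqP l0] := eqVneq l \bot%O; first by constructor 1.
have [|ns] := classic (exists k, succ k l); first by constructor 2.
by constructor 3; split=> // k kl; apply: ns; exists k.
Qed.

Lemma limit_key l : l <> \bot%O -> (forall k, ~ succ k l) ->
  limit_condition nu alpha Q l.
Proof. by case: Q_key => _ _ _ + _; apply. Qed.

Lemma limit_next_index l k : (forall k, ~ succ k l) ->
  next_index alpha whole k l -> inessential alpha whole k /\ shift_omega k l.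
Proof. by move=> ns [_ [//|[_ /ns]]]. Qed.

Lemma pval_sum I (r : seq I) (F : I -> {poly K}) :
  pval nu (\sum_(j <- r) F j) = nu (\sum_(j <- r) tofrac (F j)).
Proof. by rewrite /pval rmorph_sum. Qed.

Lemma pvalM f h : pval nu (f * h) = eadd (pval nu f) (pval nu h).
Proof. by rewrite /pval rmorphM valuationM. Qed.

(** * Degrees of key polynomials and of standard monomials *)

Lemma size_monomial k (m : K * exponents Lam) :
  (degree (power_product Q m.2) < degree (Q k))%N ->
  (size (monomial Q m) < size (Q k))%N.
Proof.
move=> lt; have mp := power_product_monic m.2 key_monic.
rewrite /monomial (size_monic (key_monic k)) ltnS; apply: leq_trans lt.
rewrite -(size_monic mp) mul_polyC; exact: size_scale_leq.
Qed.

Lemma size_free_std_sum k (s : seq (K * exponents Lam)) :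
  (forall g, std_exponents alpha k g -> g k = 0%N ->
     (degree (power_product Q g) < degree (Q k))%N) ->
  (forall m, m \in s -> free_std_monomial alpha k m) ->
  (size (\sum_(m <- s) monomial Q m)%R < size (Q k))%N.
Proof.
move=> hk hs; rewrite big_seq.
apply: (big_ind (fun p : {poly K} => size p < size (Q k))%N).
- by rewrite size_poly0 size_poly_gt0 key_neq0.
- by move=> p p' hp hp'; apply: leq_ltn_trans (size_polyD _ _) _; rewrite gtn_max hp.
- by move=> m /hs [gm gk]; apply/size_monomial/hk.
Qed.

(** In (b) the lower powers of [Q k] have coefficients of degree below that of [Q k], so they cannot
    reach the leading term. The degree bound is a hypothesis because the lemma serves inside the
    induction of [key_degrees]. *)
Lemma succ_degree k l : succ k l ->
  (forall g, std_exponents alpha k g -> g k = 0%N ->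
     (degree (power_product Q g) < degree (Q k))%N) ->
  degree (Q l) = (alpha l * degree (Q k))%N.
Proof.
move=> kl hk; have [_ _ /(_ k l kl) [s [hs -> _ _]] _ _] := Q_key.
rewrite -degreeX /degree size_polyDl //.
apply: (@size_sum_expansion _ _ _ (fun j => \sum_(m <- s j) monomial Q m)).
  exact: key_monic.
by move=> j jl; apply: size_free_std_sum => //; case: (hs j jl).
Qed.

Lemma limit_degree k l : ~ is_max l -> next_index alpha whole k l ->
  degree (Q l) = (alpha l * degree (Q k))%N.
Proof. by case: Q_key => -[_ _ _ _ h] _ _ _ _; apply: h. Qed.

(** The claims go by a joint induction: the degree at a successor rests on the bound for free
    monomials at its predecessor. Maximal indices are left out because at a limit the degree formula
    is given only for the others. *)
Lemma key_degrees l : ~ is_max l ->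
  [/\ (0 < degree (Q l))%N,
      forall q, (q < l)%O -> (degree (Q q) <= degree (Q l))%N
    & forall g, std_exponents alpha l g -> g l = 0%N ->
        (degree (power_product Q g) < degree (Q l))%N].
Proof.
elim/(well_founded_ind wo): l => l IHl nl.
have hstd k : (k < l)%O -> forall g, std_exponents alpha k g -> g k = 0%N ->
    (degree (power_product Q g) < degree (Q k))%N.
  by move=> kl; have [_ _] := IHl k kl (nonmax kl).
have leM a p : (0 < a)%N -> (p <= a * p)%N by move=> a0; rewrite leq_pmull.
have [l_gt0 mono] : (0 < degree (Q l))%N /\
    forall q, (q < l)%O -> (degree (Q q) <= degree (Q l))%N.
  have [l0|[k kl]|[l0 ns]] := index_cases l.
  - rewrite l0 key_bot /degree size_polyX; split=> // q.
    by rewrite ltNge le0x.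
  - have [k_gt0 kmono _] := IHl k kl.1 (nonmax kl.1).
    have leQ : (degree (Q k) <= degree (Q l))%N.
      by rewrite (succ_degree kl (hstd k kl.1)) leM // key_alpha_gt0.
    split; first exact: leq_trans leQ.
    move=> q /(le_succ kl); rewrite le_eqVlt => /orP[/eqP -> //|/kmono qk].
    exact: leq_trans leQ.
  - have [[k kl] _ _ _ _] := limit_key l0 ns.
    have [ik kl'] := limit_next_index ns kl; have ltkl := shift_omega_gt kl'.
    have [k_gt0 kmono _] := IHl k ltkl (nonmax ltkl).
    have leQ q : next_index alpha whole q l -> (degree (Q q) <= degree (Q l))%N.
      by move=> ql; rewrite (limit_degree nl ql) leM // key_alpha_gt0.
    split; first exact: leq_trans (leQ k kl).
    move=> q ql; have [kq|/kmono qk] := leP k q.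
      exact/leQ/(next_index_limit_between kl').
    exact: leq_trans (leQ k kl).
split=> // g gstd gl.
(* As with digits in a mixed radix: for the largest [q] with [g q] nonzero, the other factors have
   degree below that of [Q q], so the total is less than [(g q).+1] times that degree, hence less
   than the degree of [Q p], where [p = q+ <= l]. *)
have [allz|/not_all_ex_not [q0 /exponents_max [q gq gout]]] :=
    classic (forall q, g q = 0%N).
  by rewrite power_product0 // /degree size_poly1.
have ql : (q < l)%O.
  rewrite lt_neqAle; have [gsupp _ _] := gstd; rewrite gsupp // andbT.
  by apply/eqP => e; rewrite e in gq.
have g'std := std_exponents_without key_alpha_gt0 gstd ql gq gout.
have := hstd q ql _ g'std; rewrite fsfun_with => /(_ erefl).
have := power_product_with Q g q 0; rewrite expr0 mul1r => <-.
rewrite degreeM ?monic_exp ?key_monic ?power_product_monic //; last exact: key_monic.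
rewrite degreeX => ltq.
have [p qp] := exists_next_index alpha wo ql.
have gqp : (g q < alpha p)%N by case: gstd => _ + _; apply.
have pl : (p <= l)%O by case: qp.
have Qp : degree (Q p) = (alpha p * degree (Q q))%N.
  case: (qp) => _ [[iq qp']|[_ qp']]; last exact: succ_degree qp' (hstd q ql).
  apply: limit_degree; first exact: nonmax_le pl nl.
  by apply: next_index_limitI qp' iq _.
have : (degree (Q p) <= degree (Q l))%N.
  by move: pl; rewrite le_eqVlt => /orP[/eqP -> //|/mono].
apply: leq_trans; rewrite Qp.
apply: leq_trans (leq_mul gqp (leqnn _)); rewrite mulSn addnC.
by rewrite ltn_add2r.
Qed.

Lemma key_degree_gt0 l : ~ is_max l -> (0 < degree (Q l))%N.
Proof. by move/key_degrees=> []. Qed.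

Lemma size_free_std l h : ~ is_max l -> free_std l h -> (size h < size (Q l))%N.
Proof.
by move=> nl [s [hs _] ->]; apply: size_free_std_sum => //; case: (key_degrees nl).
Qed.

Lemma key_degree_next k l : ~ is_max l -> next_index alpha (upto l) k l ->
  degree (Q l) = (alpha l * degree (Q k))%N.
Proof.
move=> nl kl; have ltkl := next_index_gt kl.
case: kl => _ [[ik kl]|[_ kl]].
  by apply: limit_degree => //; apply: next_index_limitI kl ik _.
by apply: succ_degree kl _; case: (key_degrees (nonmax ltkl)).
Qed.

(** * Initial forms of standard expansions and their algebra *)

Lemma init_algebra_mono k l z : (k <= l)%O ->
  init_algebra nu Q k z -> init_algebra nu Q l z.
Proof.
move=> kl; apply: subring_gen_mono => y [|[q qk ->]]; first by left.
by right; exists q => //; apply: lt_le_trans kl.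
Qed.

Lemma init_algebra_key k l : (k < l)%O -> init_algebra nu Q l (pinit nu (Q k)).
Proof. by move=> kl; apply: SubringGen; right; exists k. Qed.

Lemma init_algebra_const l c : init_algebra nu Q l (pinit nu c%:P).
Proof. by apply: SubringGen; left; exists (init _ c); rewrite gr_map_init. Qed.

Lemma init_algebra_free_std l h : free_std l h ->
  init_algebra nu Q l (pinit nu h).
Proof.
move=> [s [hs]]; rewrite pval_sum => /valuation_sum_min hmin ->.
rewrite /pinit rmorph_sum; apply: init_sum_subring_gen => // m /hs [[gsupp _ _] gl].
rewrite rmorphM initM; apply: SubringGenM; first exact: init_algebra_const.
rewrite /power_product rmorph_prod init_prod.
apply: subring_gen_prod => q; rewrite mem_finsupp => /eqP gq.
rewrite rmorphXn initX; apply/subring_genX/init_algebra_key.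
by rewrite lt_neqAle gsupp // andbT; apply/eqP => e; rewrite e in gq.
Qed.

(** Absence of cancellation: the value of the sum is the minimum over its terms, in the termwise
    form of [valuation_sum_min]. *)
Definition sharp k n C : Prop := forall j, (j < n)%N ->
  ele (pval nu (\sum_(j < n) C j * Q k ^+ j)) (pval nu (C j * Q k ^+ j)).

(** [S] is arbitrary because the relation is taken over the fractions at a successor index, but over
    the algebra itself at [i]. *)
Lemma init_relation_key k n C (S : gr nu -> Prop) : S 0 ->
  (forall j, (j < n)%N -> S (pinit nu (C j))) -> ~ sharp k n C ->
  exists P : {poly gr nu},
    [/\ coefs_in S P, P != 0, (size P <= n)%N & P.[pinit nu (Q k)] = 0].
Proof.
move=> S0 SC nsharp.
apply: (@init_relation _ _ nu S n (fun j => tofrac (C j)) (tofrac (Q k))) => //.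
have term j : tofrac (C j) * tofrac (Q k) ^+ j = tofrac (C j * Q k ^+ j).
  by rewrite rmorphM rmorphXn.
under eq_bigr => j _ do rewrite term.
apply/negP => /allP h; apply: nsharp => j jn.
by have := h (Ordinal jn) (mem_index_enum _); rewrite term -pval_sum.
Qed.

Lemma init_algebra_sharp k l n C : (k < l)%O -> sharp k n C ->
  (forall j, (j < n)%N -> free_std k (C j)) ->
  init_algebra nu Q l (pinit nu (\sum_(j < n) C j * Q k ^+ j)).
Proof.
move=> kl hsharp hC; rewrite /pinit rmorph_sum; apply: init_sum_subring_gen.
  apply/allP => j _; rewrite -pval_sum; exact: hsharp.
move=> j _; rewrite rmorphM rmorphXn initM initX; apply: SubringGenM.
  by apply: init_algebra_mono (ltW kl) _; apply/init_algebra_free_std/hC.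
exact/subring_genX/init_algebra_key.
Qed.

(** * Existence of standard expansions in small degree *)

Definition all_free_std l : Prop :=
  forall h, (size h < size (Q l))%N -> free_std l h.

Lemma free_std_bot : all_free_std \bot%O.
Proof.
move=> h; rewrite key_bot size_polyX ltnS => /size1_polyC ->.
exists [:: (h`_0, [fsfun for fun=> 0%N])]; last first.
  rewrite big_seq1 /monomial power_product0 ?mulr1 // => q; exact: fsfun0E.
split=> [m|]; last by rewrite !big_seq1 big_cons big_nil /emin; case: (pval _ _).
rewrite inE => /eqP ->; split; last exact: fsfun0E.
exact/std_exponents0/key_alpha_gt0.
Qed.

(** Expanding each coefficient turns the sum into monomials times powers of [Q k], and the two
    minimum conditions compose. The degree bound, by uniqueness of the expansion, kills the
    coefficients from [alpha l] on, as the bound on the exponent of [Q k] requires. *)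
Lemma free_std_sharp l k n C : ~ is_max l -> next_index alpha (upto l) k l ->
  (forall j, (j < n)%N -> free_std k (C j)) -> sharp k n C ->
  (size (\sum_(j < n) C j * Q k ^+ j)%R < size (Q l))%N ->
  free_std l (\sum_(j < n) C j * Q k ^+ j).
Proof.
move=> nl kl hC hsharp hsize; have ltkl := next_index_gt kl.
have C0 j : (j < n)%N -> (alpha l <= j)%N -> C j = 0.
  move=> jn lj; have hs j' : (j' < n)%N -> (size (C j') < size (Q k))%N.
    by move=> /hC; apply: size_free_std; apply: nonmax ltkl.
  have := expansion_coef j (key_neq0 k) hs; rewrite jn => <-.
  rewrite divp_small ?mod0p //; apply: leq_trans hsize _.
  rewrite !size_monic ?monic_exp ?key_monic // ltnS degreeX.
  by rewrite (key_degree_next nl kl) leq_mul2r lj orbT.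
(* A zero coefficient may come with a nonempty list of zero monomials; from [alpha l] on the empty
   list is chosen, so that no exponent reaches [alpha l]. *)
have /fin_all_exists [s hs] : forall j : 'I_n, exists s,
    [/\ free_std_sum nu alpha Q k s, C j = \sum_(m <- s) monomial Q m
      & s != [::] -> (j < alpha l)%N].
  move=> j; have [jl|lj] := ltnP j (alpha l).
    by have [s sj ej] := hC j (ltn_ord j); exists s.
  exists [::]; split=> //; last by rewrite big_nil C0.
  by split=> //; rewrite !big_nil; apply/valuation0.
have monE (m : K * exponents Lam) j : m.2 k = 0%N ->
    monomial Q (m.1, [fsfun m.2 with k |-> j]) = monomial Q m * Q k ^+ j.
  move=> mk; have := power_product_with Q m.2 k j; rewrite mk expr0 mul1r.
  by rewrite /monomial /= => ->; rewrite mulrCA mulrC.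
pose S := [seq (m.1, [fsfun m.2 with k |-> nat_of_ord j]) |
             j : 'I_n <- index_enum 'I_n, m : K * exponents Lam <- s j].
have sk (j : 'I_n) m : m \in s j -> m.2 k = 0%N.
  by move=> mj; have [[h _] _ _] := hs j; case: (h m mj).
have ES : \sum_(j < n) C j * Q k ^+ j = \sum_(m <- S) monomial Q m.
  rewrite big_allpairs_dep; apply: eq_bigr => j _.
  have [_ -> _] := hs j; rewrite mulr_suml big_seq [RHS]big_seq.
  by apply: eq_bigr => m /sk mk; rewrite monE.
exists S => //; split.
  move=> _ /allpairsPdep [j [m [_ mj ->]]]; have [[h _] _ sj] := hs j.
  have [mstd mk] := h m mj; apply: std_exponents_with => //.
    exact: key_alpha_gt0.
  by apply: sj; apply/eqP => e; rewrite e in mj.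
rewrite pval_sum; apply/valuation_sum_min/allP => _ /allpairsPdep [j [m [_ mj ->]]].
rewrite -pval_sum -ES /= monE ?(sk j) //.
apply: ele_trans (hsharp j (ltn_ord j)) _.
rewrite -/(pval _ _) pvalM (pvalM (monomial Q m)).
apply: leD2r_ele; have [[_ +] -> _] := hs j.
by rewrite pval_sum => /valuation_sum_min/allP/(_ m mj).
Qed.

(** At a limit, possibly maximal, (c) replaces the degree formula: a constant [Q i] would be 1,
    whose one-term expansion has minimum equal to its value, against the strict inequality. *)
Lemma size_key_gt1 i : (forall k, (k < i)%O -> all_free_std k) ->
  (1 < size (Q i))%N.
Proof.
move=> IH; rewrite (size_monic (key_monic i)) ltnS.
have [->|[k kl]|[i0 ns]] := index_cases i.
- by rewrite key_bot /degree size_polyX.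
- have nk := nonmax kl.1; rewrite (succ_degree kl) ?muln_gt0; last first.
    by case: (key_degrees nk).
  by rewrite key_alpha_gt0 key_degree_gt0.
- have [[k kl] _ hexc _ _] := limit_key i0 ns; have [_ hC] := hexc k kl.
  have ltki := next_index_gt kl.
  rewrite lt0n; apply/negP => /eqP deg0.
  have Q1 : Q i = 1.
    have := key_monic i; rewrite monicE lead_coefE -/(degree _) deg0 => /eqP c1.
    have : (size (Q i) <= 1)%N by rewrite (size_monic (key_monic i)) deg0.
    by move/size1_polyC ->; rewrite c1.
  have : std_expansion nu alpha Q k (Q i) [:: 1].
    split=> [c|]; last by rewrite /expansion big_ord1 expr0 mulr1.
    rewrite inE => /eqP ->; apply: IH => //; rewrite size_poly1.
    by rewrite (size_monic (key_monic k)) ltnS key_degree_gt0 //; apply: nonmax ltki.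
  move/hC; rewrite /min_term big_ord_recl big_ord0 Q1 /= expr0 mulr1.
  by case: (pval nu 1) => [b|] //; rewrite /emin /= eltxx.
Qed.

(* At a successor [succ k i], cancellation in the [Q k]-expansion would give a
   relation of degree less than [alpha i]; at a limit, it would contradict the
   minimality of the degree of [Q i]. *)
Lemma sharp_expansion i h : (forall k, (k < i)%O -> all_free_std k) ->
  i <> \bot%O -> (size h < size (Q i))%N ->
  exists k n C, [/\ next_index alpha (upto i) k i,
    forall j, (j < n)%N -> free_std k (C j), sharp k n C
    & h = \sum_(j < n) C j * Q k ^+ j].
Proof.
move=> IH i0 hi; have qcoef_std k j : (k < i)%O -> free_std k (qcoef Q k h j).
  by move=> ki; apply: IH => //; apply: size_qcoef; apply: key_neq0.
have [//|[k ki]|[_ ns]] := index_cases i.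
- have nk := nonmax ki.1; have ltki := ki.1.
  have kstd := qcoef_std k ^~ ltki.
  have ki' : next_index alpha (upto i) k i.
    apply: next_index_succ => // -[[p pi kp] _].
    have e : p = i by apply: le_anti; rewrite pi (succ_le ki (shift_omega_gt kp)).
    by rewrite e in kp; apply: shift_omega_nsucc kp ki.
  exists k, (alpha i), (qcoef Q k h); split=> //.
    have [_ _ /(_ k i ki) [s [_ _ _ [_ _ _ Pmin]]] _ _] := Q_key.
    have S0 : saturation (init_algebra nu Q k) 0.
      by apply: sub_saturation; apply: subring_gen0.
    apply: NNPP => /(init_relation_key S0) [j _|P [PS P0 Psize Proot]].
      exact/sub_saturation/init_algebra_free_std.
    (* The minimal relation has size [(alpha i).+1], the one found has size at most [alpha i]. *)
    have := leq_trans (Pmin P PS P0 Proot) Psize.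
    rewrite (size_Xn_add_lower _ (fun j => \sum_(m <- s j)
      gr_map (constf K) nu (init (nuK nu) m.1) * pinit nu (power_product Q m.2))).
    by rewrite ltnn.
  apply: expansion_sum; apply: leq_trans hi _.
  rewrite !size_monic ?monic_exp ?key_monic // degreeX (succ_degree ki) //.
  by case: (key_degrees nk).
- have : ~ exceeds_expansions nu alpha Q i h.
    have [_ _ _ + _] := limit_key i0 ns => /[apply].
    by have := hi; have := size_key_gt1 IH; rewrite /degree; lia.
  case/not_all_ex_not => k nexc; have {nexc} [ki nexc] := imply_to_and _ _ nexc.
  have ltki := next_index_gt ki; have [ik ki'] := limit_next_index ns ki.
  (* The existence clause of [exceeds_expansions] is met by the [Q k]-expansion of [h], so it is the
     strict inequality that fails, for some standard expansion [c]. *)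
  have [c [hc ec] le] : exists2 c, std_expansion nu alpha Q k h c
      & ~~ elt (min_term nu Q k c) (pval nu h).
    apply: NNPP => none; apply: nexc; split=> [|c hc]; last first.
      by case e: (elt _ _) => //; case: none; exists c; rewrite // e.
    exists (mkseq (qcoef Q k h) (size h)); split=> [_ /mapP [j _ ->]|].
      exact: qcoef_std.
    rewrite /expansion size_mkseq [LHS](@qcoefE _ _ _ Q k h); last first.
      by apply: size_key_gt1 => q qk; apply: IH; apply: lt_trans ltki.
    by apply: eq_bigr => j _; rewrite nth_mkseq.
  exists k, (size c), (nth 0 c); split=> //.
  + by apply: next_index_limitI ki' ik _; apply: lexx.
  + by move=> j jc; apply/hc/mem_nth.
  + move: le; rewrite /elt negbK /min_term.
    rewrite (ele_bigemin _ _ (fun j : 'I_(size c) => pval nu (c`_j * Q k ^+ j))).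
    rewrite ec => /allP le j jc; exact: (le (Ordinal jc) (mem_index_enum _)).
Qed.

Lemma all_free_std_key l : ~ is_max l -> all_free_std l.
Proof.
elim/(well_founded_ind wo): l => l IHl nl.
have IH k : (k < l)%O -> all_free_std k by move=> kl; apply: IHl (nonmax kl).
have [->|/eqP l0] := eqVneq l \bot%O; first exact: free_std_bot.
move=> h hl; have [k [n [C [kl hC hsharp eh]]]] := sharp_expansion IH l0 hl.
by rewrite eh; apply: free_std_sharp => //; rewrite -eh.
Qed.

(** Since [i] may be maximal, an [i]-standard expansion of [h] is not at hand; a sharp expansion in
    some [Q k] with [k < i] already places the initial form in the algebra. *)
Lemma init_algebra_small i h : (size h < size (Q i))%N ->
  init_algebra nu Q i (pinit nu h).
Proof.
have [->|/eqP i0] := eqVneq i \bot%O.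
  by rewrite key_bot size_polyX ltnS => /size1_polyC ->; apply: init_algebra_const.
have IH k : (k < i)%O -> all_free_std k by move/nonmax/all_free_std_key.
move/(sharp_expansion IH i0) => [k [n [C [ki hC hsharp ->]]]].
by apply: init_algebra_sharp => //; apply: next_index_gt ki.
Qed.

(** * Consequences of the transcendence of the initial form of [Q i] *)

Lemma transcendental_max i :
  transcendental_over (init_algebra nu Q i) (pinit nu (Q i)) -> is_max i.
Proof.
move=> htr l; rewrite leNgt; apply/negP => /(exists_succ wo) [j ij].
have [_ _ /(_ i j ij) [s [_ _ _ [Pmonic Psat Proot _]]] _ _] := Q_key.
have [h [h' [_ hh' hP]]] := clear_denominators Psat.
(* [h] is a unit and [P] is monic, so the cleared relation is still nonzero. *)
case: (scale_monic_neq0 hh' Pmonic); apply: (htr _ hP).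
by rewrite hornerZ Proot mulr0.
Qed.

(** A cancellation in the [Q i]-expansion would be a relation with coefficients in the algebra. The
    truncation at [i] is therefore exact on every [f], so one index serves for completeness. *)
Lemma transcendental_truncation i f :
  transcendental_over (init_algebra nu Q i) (pinit nu (Q i)) ->
  truncation nu Q i f = pval nu f.
Proof.
move=> htr; have Q1 : (1 < size (Q i))%N.
  by apply: size_key_gt1 => k /nonmax/all_free_std_key.
have hsharp : sharp i (size f) (qcoef Q i f).
  have S0 : init_algebra nu Q i 0 by apply: subring_gen0.
  apply: NNPP => /(init_relation_key S0) [j _|P [PS /eqP P0 _ /(htr P PS)//]].
  by apply: init_algebra_small; apply: size_qcoef; apply: key_neq0.
rewrite [in RHS](qcoefE f Q1) pval_sum; symmetry.
rewrite /truncation (eq_bigr (fun j : 'I_(size f) =>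
  nu (tofrac (qcoef Q i f j * Q i ^+ j)))); last first.
  move=> j _; rewrite rmorphM rmorphXn valuationM valuationX //.
  by rewrite tofrac_eq0 key_neq0.
apply/valuation_sum_min/allP => j _; rewrite -pval_sum; exact: hsharp.
Qed.

End KeyPolynomials.

Theorem proposition3p36 (K : fieldType) (G : ordGroupType)
    (nu : valuation {fraction {poly K}} G)
    (nu_onto : forall g, value_group nu g)
    (rank_nuK : rank_one (value_group (nuK nu)))
    (nuX_gt0 : elt (Some 0) (pval nu 'X))
    (d : Order.disp_t) (Lam : bOrderType d)
    (Lam_wo : well_ordered Lam) (Lam_countable : countable_type Lam)
    (alpha : Lam -> nat) (Q : Lam -> {poly K})
    (Q_key : key_polynomials nu alpha Q) (i : Lam)
    (Qi_trans : transcendental_over (init_algebra nu Q i) (pinit nu (Q i))) :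
  (forall l : Lam, (l <= i)%O) /\ complete nu Q.
Proof.
split; first exact: (transcendental_max Lam_wo Q_key Qi_trans).
move=> f _; exists i; exact: (transcendental_truncation Lam_wo Q_key f Qi_trans).
Qed.
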